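(* Let $\mathcal{A}=\{\mathbf{A}_i\}_{i\in[n]}$ and $\mathbf{B}$ be symmetric $d\times d$ real matrices, $c\in\mathbb{R}^n$, and let $L_{\mathcal{A}}:=\left\|\sum_{i\in[n]}|\mathbf{A}_i|\right\|_{\mathrm{op}}$. Let $\epsilon\in(0,L_{\mathcal{A}})$ and $\delta\in(0,1)$. There is an algorithm which computes an $\epsilon$-approximate saddle point to $$\min_{x\in[-1,1]^n}\ \max_{\mathbf{Y}\in\Delta^{d\times d}}\ \langle\mathbf{Y},\mathcal{A}(x)\rangle-\langle\mathbf{B},\mathbf{Y}\rangle+c^\top x$$ in $T=O\left(\frac{L_{\mathcal{A}}\log d}{\epsilon}\right)$ iterations, with probability at least $1-\delta$, each iteration using $O(1)$ calls to a $\left(\Theta\left(\frac{\epsilon}{L_{\mathcal{A}}}\right),\frac{\delta}{O(T)},\Theta\left(\frac{\epsilon}{L_{\mathcal{A}}nd}\right)\right)$-MEQ oracle for $\{\mathbf{A}_i,|\mathbf{A}_i|\}_{i\in[n]}$ and matrices of the form $\mathbf{M}=\mathcal{A}(w)+|\mathcal{A}|(w')+\beta\mathbf{B}$, where $w,w'\in\mathbb{R}^n$, $\beta\in\mathbb{R}$ satisfy $\|w\|_\infty,\|w'\|_\infty,|\beta|=O(T)$.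
   Context: $[n]=\{1,\dots,n\}$. $\Delta^{d\times d}$ is the set of positive semidefinite symmetric $d\times d$ matrices of trace $1$; $\langle\mathbf{A},\mathbf{B}\rangle=\mathrm{Tr}(\mathbf{A}\mathbf{B})$. For symmetric $\mathbf{A}$, $|\mathbf{A}|$ is the spectral absolute value (eigenvalues replaced by absolute values) and $\|\mathbf{A}\|_{\mathrm{op}}$ is the largest eigenvalue of $|\mathbf{A}|$. For $x\in\mathbb{R}^n$, $\mathcal{A}(x)=\sum_i x_i\mathbf{A}_i$ and $|\mathcal{A}|(x)=\sum_i x_i|\mathbf{A}_i|$. Denoting the objective by $f(x,\mathbf{Y})$, a point $(x,\mathbf{Y})$ of the domain is an $\epsilon$-approximate saddle point if $\max_{\mathbf{Y}'}f(x,\mathbf{Y}')-\min_{x'}f(x',\mathbf{Y})\le\epsilon$ (max and min over the respective domains). MEQ (matrix exponential query) oracle: for $\epsilon',\delta',\gamma'\in(0,1)$, an $(\epsilon',\delta',\gamma')$-MEQ oracle for symmetric matrices $\{\mathbf{C}_j\}_{j\in[N]}$ and a symmetric matrix $\mathbf{M}$ (all $d\times d$) returns numbers $\{V_j\}_{j\in[N]}$ such that, with probability at least $1-\delta'$, $|V_j-\langle\mathbf{C}_j,\mathbf{Y}\rangle|\le\epsilon'\langle|\mathbf{C}_j|,\mathbf{Y}\rangle+\gamma'\,\mathrm{Tr}(|\mathbf{C}_j|)$ for all $j\in[N]$, where $\mathbf{Y}=\exp(\mathbf{M})/\mathrm{Tr}\exp(\mathbf{M})$. The factor $\log d$ is understood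 for $d\ge2$.
   Formalization: The bound on ‖w‖∞, ‖w'‖∞, |β| is proved as O(T/L_A) instead of O(T), i.e. O(T) for data normalized by L_A; the literal O(T) fails for small L_A when A and B are accessed only through the oracle. *)

(* Defs.v *)
From HB Require Import structures.
From mathcomp Require Import all_boot all_order all_algebra.
From mathcomp Require Import all_classical all_reals all_analysis.
Import Order.TTheory GRing.Theory Num.Theory numFieldNormedType.Exports.

Set Implicit Arguments.
Unset Strict Implicit.
Unset Printing Implicit Defensive.

Local Open Scope classical_set_scope.
Local Open Scope ring_scope.

Section Matrices.
Context {R : realType}.

Definition mxinner d (A B : 'M[R]_d) : R := \tr (A *m B).

Definition mxsym d (A : 'M[R]_d) : Prop := A^T = A.

(* |A|: diagonalize A = P^T D P with P orthogonal and replace D by its entrywise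
   absolute value. For symmetric A such a diagonalization exists and the result
   does not depend on it; for other A the value is irrelevant. *)
Definition mxabs d (A : 'M[R]_d) : 'M[R]_d :=
  xget 0 [set S | exists (P : 'M[R]_d) (D : 'rV[R]_d),
    [/\ P *m P^T = 1%:M, A = P^T *m diag_mx D *m P
      & S = P^T *m diag_mx (map_mx Num.norm D) *m P]].

(* The supremum ranges over a finite set, nonempty for symmetric A and d > 0. *)
Definition opnorm d (A : 'M[R]_d) : R :=
  sup [set a | eigenvalue (mxabs A) a].

Definition mxexp d (M : 'M[R]_d) : 'M[R]_d :=
  lim (series (fun k => k`!%:R^-1 *: M ^+ k) @ \oo).

Definition gibbs d (M : 'M[R]_d) : 'M[R]_d :=
  (\tr (mxexp M))^-1 *: mxexp M.

Definition spectraplex d : set 'M[R]_d :=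
  [set Y | [/\ mxsym Y, forall v : 'rV[R]_d, 0 <= (v *m Y *m v^T) 0 0
             & \tr Y = 1]].

Definition box n : set 'cV[R]_n := [set x | forall i, -1 <= x i 0 <= 1].

Definition lincomb n d (A : 'I_n -> 'M[R]_d) (x : 'cV[R]_n) : 'M[R]_d :=
  \sum_i x i 0 *: A i.

Definition mxabs_family n d (A : 'I_n -> 'M[R]_d) : 'I_n -> 'M[R]_d :=
  fun i => mxabs (A i).

Definition family_norm n d (A : 'I_n -> 'M[R]_d) : R :=
  opnorm (\sum_i mxabs (A i)).

Definition objective n d (A : 'I_n -> 'M[R]_d) (B : 'M[R]_d) (c : 'cV[R]_n)
    (x : 'cV[R]_n) (Y : 'M[R]_d) : R :=
  mxinner Y (lincomb A x) - mxinner B Y + (c^T *m x) 0 0.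

End Matrices.

(* Both domains are compact and f is meant to be continuous, so that the
   supremum and the infimum are a maximum and a minimum. *)
Definition approx_saddle (R : realType) (X Z : Type) (DX : set X) (DZ : set Z)
    (f : X -> Z -> R) (eps : R) (x : X) (z : Z) : Prop :=
  [/\ DX x, DZ z
    & sup [set f x z' | z' in DZ] - inf [set f x' z | x' in DX] <= eps].

Section Oracle.
Context {R : realType}.

(* An oracle answer is a random vector V in R^N, given by its law P. *)
Definition meq_law N d (eps' delta' gamma' : R) (C : 'I_N -> 'M[R]_d)
    (M : 'M[R]_d) (P : probability (N.-tuple R) R) : Prop :=
  let good := [set V : N.-tuple R | forall j,
    `|tnth V j - mxinner (C j) (gibbs M)|
    <= eps' * mxinner (mxabs (C j)) (gibbs M) + gamma' * \tr (mxabs (C j))] in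
  ((1 - delta')%:E <= P good)%E.

(* The family {A_i, |A_i|}: indices 0..n-1 are the A_i, n..2n-1 the |A_i|. *)
Definition with_abs n d (A : 'I_n -> 'M[R]_d) (j : 'I_(n + n)) : 'M[R]_d :=
  match fintype.split j with inl i => A i | inr i => mxabs (A i) end.

Record query n := Query {
  q_w : 'cV[R]_n;
  q_w' : 'cV[R]_n;
  q_beta : R }.

Definition query_mx n d (A : 'I_n -> 'M[R]_d) (B : 'M[R]_d) (q : query n) :
    'M[R]_d :=
  lincomb A (q_w q) + lincomb (mxabs_family A) (q_w' q) + q_beta q *: B.

Definition query_bounded n (b : R) (q : query n) : Prop :=
  [/\ forall i, `|q_w q i 0| <= b, forall i, `|q_w' q i 0| <= b
    & `|q_beta q| <= b].

End Oracle.
Arguments query R n : clear implicits.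

Section Procedures.
Context {R : realType}.

(* Adaptive computation: each call may depend on all earlier answers. *)
Inductive proc (Q V S : Type) : Type :=
| Ret of S
| Call of Q & (V -> proc Q V S).

Fixpoint bind Q V S S' (p : proc Q V S) (k : S -> proc Q V S') : proc Q V S' :=
  match p with
  | Ret s => k s
  | Call q r => Call q (fun v => bind (r v) k)
  end.

Fixpoint calls_le Q V S (K : nat) (p : proc Q V S) : Prop :=
  match p, K with
  | Ret _, _ => True
  | Call _ _, 0%N => False
  | Call _ r, K'.+1 => forall v, calls_le K' (r v)
  end.

Fixpoint all_queries Q V S (P : Q -> Prop) (p : proc Q V S) : Prop :=
  match p with
  | Ret _ => True
  | Call q r => P q /\ forall v, all_queries P (r v)
  end.

(* Probability that the result lies in E when every call q is answered by a
   fresh sample of law orc q. Since \int of a nonnegative function is a supremum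
   over measurable simple functions below it, it is an inner integral if the
   integrand is not measurable; lower bounds on this quantity are then
   conservative. *)
Fixpoint prob_in d (V : measurableType d) Q S (orc : Q -> probability V R)
    (p : proc Q V S) (E : set S) : \bar R :=
  match p with
  | Ret s => (\1_E s : R)%:E
  | Call q r => (\int[orc q]_v prob_in orc (r v) E)%E
  end.

End Procedures.

(* An iterative method whose only access to the matrices is by oracle calls.
   The matrix part of its output is implicit: a list of pairs (p, q) stands for
   the sum of the p *: gibbs (query_mx A B q), see mx_of_output. *)
Record algorithm (R : realType) (n : nat) := Algorithm {
  state : Type;
  start : state;
  iter_step : state -> proc (query R n) ((n + n).-tuple R) state;
  iterations : nat;
  output_x : state -> 'cV[R]_n;
  output_Y : state -> seq (R * query R n);
  or_eps : R;
  or_delta : R;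
  or_gamma : R }.

Fixpoint run_from (R : realType) n (a : algorithm R n) (T : nat) (s : state a) :
    proc (query R n) ((n + n).-tuple R) (state a) :=
  if T is T'.+1 then bind (iter_step s) (fun s' => run_from T' s') else Ret _ _ s.

Definition run (R : realType) n (a : algorithm R n) :=
  run_from (iterations a) (start a).

Definition mx_of_output (R : realType) n d (A : 'I_n -> 'M[R]_d) (B : 'M[R]_d)
    (l : seq (R * query R n)) : 'M[R]_d :=
  \sum_(pq <- l) pq.1 *: gibbs (query_mx A B pq.2).

(* Main.v *)
Require Import Defs.
From HB Require Import structures.
From mathcomp Require Import all_boot all_order all_algebra.
From mathcomp Require Import all_classical all_reals all_analysis.
From mathcomp Require Import complex ring lra.

(** Write Q(x) = |A|(x^2), the square being entrywise, Phi(M) = ln Tr exp M, and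
    L for the operator norm of the sum of the |A_i|. The algorithm is an explicit
    form of dual extrapolation with the area-convex regularizer
    <Y, Q(x)> + alpha H(Y), where alpha = 144 L. From x_0 = 0, round t asks the
    oracle about the Gibbs matrix Y_t of
      (1/alpha) (sum_{s<t} (A(x_s) - B) + (A(x_{t-1}) - B) - Q(x_{t-1})),
    in which the unknown payoff A(x_t) - B is predicted by the preceding one; it adds
    the estimate g_t of the gradient in x to G_t = sum_{s<=t} g_s, and x_t minimises
    <G_t, x> + <Y_t, Q(x)> over the box, a minimisation in each coordinate
    separately. The output is the pair of averages.

    A rate 1/T, instead of 1/sqrt(T), comes from errors of second order that cancel.
    For a point y of the box that is thought of as the next play, the potential
      alpha Phi((sum_{s<=t} (A(x_s) - B) - Q(y) + Q(y - x_t)/2) / alpha)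
    exceeds its value of the round before, taken at y = x_t, by at most
      <Y_t, A(x_t) - B> + <Y_t, Q(x_t) - Q(y) + Q(y - x_t)>        (potential_step),
    and optimality of x_t bounds the last term by <G_t, y - x_t> (best_response_le).
    Nothing quadratic is left. Summation by parts turns the sum of the <G_t, y - x_t>
    into the regret of the x-player, and the comparator u in the duality gap may
    serve as the play that follows x_T. Hence the gap of the averages is at most
    (alpha ln d + L) / T plus a multiple of the oracle error (saddle_of_progress).

    The inequality potential_step needs Phi(M + H) <= Phi(M) + <Y, H> + 2 <Y, H^2>
    for small H and Y the Gibbs matrix of M (logpart_smooth), which follows from the
    Golden-Thompson inequality; convexity of Phi (logpart_tangent); and the operator
    inequality A(h)^2 <= L |A|(h^2) (fam_sq_le), which measures a movement h of the
    x-player in the norm given by Q. The summand Q(y - x_t)/2 of the potential is the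
    device that makes the errors cancel: the prediction error of round t is measured
    by Y_t, whereas optimality of x_{t-1} controls the movement x_t - x_{t-1} only as
    measured by Y_{t-1}; the summand carries it from one round to the next.

    Each answer is accurate with probability at least 1 - delta/T whatever the
    earlier answers were, so all T are with probability at least
    (1 - delta/T)^T >= 1 - delta (prob_in_run). *)

Import Order.TTheory GRing.Theory Num.Theory numFieldNormedType.Exports.
Set Implicit Arguments.
Unset Strict Implicit.
Unset Printing Implicit Defensive.
Local Open Scope classical_set_scope.
Local Open Scope ring_scope.


(** * Spectral theorem for real symmetric matrices *)

Section RealSpectral.
Variable R : rcfType.

(** Over the complex numbers the matrix is Hermitian, so that its eigenvalues are
    real; a real root of the characteristic polynomial is an eigenvalue over R. *)
Lemma sym_eigenvector n (A : 'M[R]_n.+1) : A^T = A ->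
  exists a, eigenvalue A a.
Proof.
move=> symA; pose f := [the {rmorphism R -> R[i]} of real_complex R].
have herm : (map_mx f A) \is hermsymmx.
  apply: realsym_hermsym.
    by apply/is_hermitianmxP; rewrite expr0 scale1r map_mx_id // map_trmx symA.
  by apply/mxOverP => i j; rewrite mxE /=; apply/complex_realP; exists (A i j).
have /orthomx_spectralP := hermitian_normalmx herm.
set P := spectralmx _; set D := spectral_diag _ => defA.
have Dreal : D 0 0 \is Num.real.
  by have /mxOverP := hermitian_spectral_diag_real herm; apply.
have /complex_realP[a Da] := Dreal.
exists a; rewrite eigenvalue_root_char -(fmorph_root f) map_char_poly.
have -> : f a = D 0 0 by rewrite Da.
rewrite -eigenvalue_root_char; apply/eigenvalueP; exists (row 0 P).
  rewrite [X in _ *m X]defA !mulmxA -row_mul mulmxV ?spectral_unit//.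
  by rewrite -row_mul mul1mx row_diag_mx -scalemxAl -rowE.
apply/eqP => P0; have : P *m invmx P = 1%:M by rewrite mulmxV ?spectral_unit.
move/(congr1 (row 0)); rewrite row_mul P0 mul0mx => /rowP/(_ 0).
by rewrite !mxE eqxx => /esym/eqP; rewrite oner_eq0.
Qed.

Lemma sqr_rv_gt0 n (v : 'rV[R]_n) : v != 0 -> 0 < (v *m v^T) 0 0.
Proof.
move=> v0; rewrite mxE.
have [j vj] : exists j, v 0 j != 0 by apply/rV0Pn.
rewrite (bigD1 j) //= ltr_wpDr //; first by apply: sumr_ge0 => i _; rewrite !mxE -expr2 sqr_ge0.
by rewrite !mxE -expr2 exprn_even_gt0.
Qed.

(** The Householder reflection that exchanges v and the first basis vector. *)
Lemma orth_first_row n (v : 'rV[R]_n.+1) : (v *m v^T) 0 0 = 1 ->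
  exists P : 'M[R]_n.+1, P *m P^T = 1%:M /\ row 0 P = v.
Proof.
move=> v1; pose e : 'rV[R]_n.+1 := delta_mx 0 0.
have sc (M : 'M[R]_1) : M = (M 0 0)%:M by rewrite [LHS]mx11_scalar.
have e1 : e *m e^T = 1%:M.
  by rewrite /e trmx_delta mul_delta_mx; apply/matrixP => i j; rewrite !mxE !ord1.
have [->|vNe] := eqVneq v e.
  exists 1%:M; rewrite trmx1 mulmx1; split=> //.
  by rewrite row1.
pose w := v - e; pose s := (w *m w^T) 0 0.
have s0 : s != 0 by rewrite gt_eqF ?sqr_rv_gt0 // subr_eq0.
pose P : 'M[R]_n.+1 := 1%:M - (2 / s) *: (w^T *m w).
have PT : P^T = P by rewrite /P linearB /= trmx1 linearZ /= trmx_mul trmxK.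
have ww : w^T *m w *m (w^T *m w) = s *: (w^T *m w).
  by rewrite mulmxA -(mulmxA _ w) (sc (w *m w^T)) -/s mul_mx_scalar scalemxAl.
(* the value of s that makes the reflection send e to e + w = v *)
have sE : s = - (2 * (e *m w^T) 0 0).
  have -> : e *m w^T = e *m v^T - 1%:M by rewrite /w linearB /= mulmxBr e1.
  have -> : s = (v *m v^T - v *m e^T - (e *m v^T - e *m e^T)) 0 0.
    by rewrite /s /w linearB /= mulmxBl !mulmxBr.
  have -> : v *m e^T = (e *m v^T)^T by rewrite trmx_mul trmxK.
  rewrite e1 (sc (v *m v^T)) v1 (sc (e *m v^T)) tr_scalar_mx.
  by rewrite !mxE /=; ring.
exists P; split.
  rewrite PT /P; move: (w^T *m w) ww => W ww.
  rewrite mulmxBl !mulmxBr !mul1mx mulmx1 -!scalemxAl -!scalemxAr ww !scalerA.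
  rewrite (_ : 2 / s * (2 / s) * s = 2 / s + 2 / s); last by field.
  by rewrite scalerDl opprB addrK subrK.
rewrite rowE -/e /P mulmxBr mulmx1 -scalemxAr mulmxA (sc (e *m w^T)) mul_scalar_mx.
rewrite scalerA (_ : 2 / s * _ = -1).
  by rewrite scaleN1r opprK /w addrC subrK.
by rewrite sE in s0 *; field; move: s0; rewrite oppr_eq0 mulf_eq0 negb_or => /andP[].
Qed.

(** Deflation: in an orthonormal basis that starts with an eigenvector, a symmetric
    matrix is block diagonal. *)
Theorem sym_spectral n (A : 'M[R]_n) : A^T = A ->
  exists (P : 'M[R]_n) (D : 'rV[R]_n), P *m P^T = 1%:M /\
    A = P^T *m diag_mx D *m P.
Proof.
elim: n A => [|n IHn] A symA.
  by exists 1%:M, 0; split; apply/matrixP => -[].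
have [a /eigenvalueP[v vA v0]] := sym_eigenvector symA.
pose u := (Num.sqrt ((v *m v^T) 0 0))^-1 *: v.
have vv0 := sqr_rv_gt0 v0.
have uA : u *m A = a *: u by rewrite -scalemxAl vA !scalerA mulrC.
have u1 : (u *m u^T) 0 0 = 1.
  rewrite /u linearZ /= -scalemxAl -scalemxAr scalerA mxE -invfM -expr2.
  by rewrite sqr_sqrtr ?ltW // mulVf // gt_eqF.
have [P [PP rP]] := orth_first_row u1.
have PP' : P^T *m P = 1%:M by apply: mulmx1C.
pose B : 'M[R]_(1 + n) := P *m A *m P^T.
have symB : B^T = B by rewrite /B !trmx_mul trmxK symA mulmxA.
have row0B : row 0 B = a *: delta_mx 0 0.
  by rewrite /B !row_mul rP uA -scalemxAl -rP -row_mul PP row1.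
have urB : ursubmx B = 0.
  apply/rowP => j; have /rowP/(_ (rshift 1 j)) := row0B.
  by rewrite !mxE (_ : lshift n 0 = 0) //; [move=> ->; rewrite mulr0|apply: val_inj].
have dlB : dlsubmx B = 0 by rewrite -symB -trmx_ursub urB trmx0.
have ulB : ulsubmx B = a%:M.
  apply/matrixP => i j; rewrite !ord1; have /rowP/(_ (lshift n 0)) := row0B.
  rewrite !mxE (_ : lshift n 0 = 0) //; [move=> ->; rewrite mulr1 //|apply: val_inj => //].
have [Q [D [QQ defD]]] : exists (Q : 'M[R]_n) (D : 'rV[R]_n), Q *m Q^T = 1%:M /\
    drsubmx B = Q^T *m diag_mx D *m Q.
  by apply: IHn; rewrite trmx_drsub symB.
have defB : B = block_mx a%:M 0 0 (drsubmx B) by rewrite -[LHS]submxK ulB urB dlB.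
pose Q1 : 'M[R]_(1 + n) := block_mx 1%:M 0 0 Q.
have Q1T : Q1^T = block_mx 1%:M 0 0 Q^T by rewrite /Q1 tr_block_mx !trmx0 trmx1.
have QQ1 : Q1 *m Q1^T = 1%:M.
  rewrite Q1T /Q1 mulmx_block !(mulmx0, mul0mx, addr0, add0r, mulmx1) QQ.
  by rewrite -scalar_mx_block.
pose E : 'rV[R]_(1 + n) := row_mx a%:M D.
have defQB : B = Q1^T *m diag_mx E *m Q1.
  rewrite defB defD diag_mx_row Q1T /Q1.
  rewrite !mulmx_block !(mulmx0, mul0mx, addr0, add0r, mulmx1, mul1mx).
  by congr block_mx; apply/matrixP => i j; rewrite !ord1 !mxE.
exists (Q1 *m P), E; split.
  by rewrite trmx_mul mulmxA -(mulmxA Q1) PP mulmx1.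
have -> : A = P^T *m B *m P by rewrite /B !mulmxA PP' mul1mx -mulmxA PP' mulmx1.
by rewrite defQB trmx_mul !mulmxA.
Qed.

End RealSpectral.

(** * Quadratic forms and matrices in spectral form *)

Section Basics.
Variables (R : realType) (d : nat).
Implicit Types (A B X Y S P : 'M[R]_d) (D E : 'rV[R]_d) (v u : 'rV[R]_d).

Definition qform X v : R := (v *m X *m v^T) 0 0.

Definition psd X := forall v, 0 <= qform X v.

Definition orthogonal_mx P := P *m P^T = 1%:M.

Definition spmx P D : 'M[R]_d := P^T *m diag_mx D *m P.

Lemma mxinnerC A B : mxinner A B = mxinner B A.
Proof. exact: mxtrace_mulC. Qed.

Lemma mxinnerDr A X Y : mxinner A (X + Y) = mxinner A X + mxinner A Y.
Proof. by rewrite /mxinner mulmxDr mxtraceD. Qed.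

Lemma mxinnerZr A (a : R) X : mxinner A (a *: X) = a * mxinner A X.
Proof. by rewrite /mxinner -scalemxAr mxtraceZ. Qed.

Lemma mxinnerNr A X : mxinner A (- X) = - mxinner A X.
Proof. by rewrite -scaleN1r mxinnerZr mulN1r. Qed.

Lemma mxinnerBr A X Y : mxinner A (X - Y) = mxinner A X - mxinner A Y.
Proof. by rewrite mxinnerDr mxinnerNr. Qed.

Lemma mxinner0r A : mxinner A 0 = 0.
Proof. by rewrite /mxinner mulmx0 mxtrace0. Qed.

Lemma mxinner_sumr I (r : seq I) (p : pred I) A (F : I -> 'M[R]_d) :
  mxinner A (\sum_(i <- r | p i) F i) = \sum_(i <- r | p i) mxinner A (F i).
Proof. by elim/big_rec2: _ => [|i x y _ <-]; rewrite ?mxinner0r ?mxinnerDr. Qed.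

Lemma qformD X Y v : qform (X + Y) v = qform X v + qform Y v.
Proof. by rewrite /qform mulmxDr mulmxDl mxE. Qed.

Lemma qformZ (a : R) X v : qform (a *: X) v = a * qform X v.
Proof. by rewrite /qform -scalemxAr -scalemxAl mxE. Qed.

Lemma qformN X v : qform (- X) v = - qform X v.
Proof. by rewrite -scaleN1r qformZ mulN1r. Qed.

Lemma qformB X Y v : qform (X - Y) v = qform X v - qform Y v.
Proof. by rewrite qformD qformN. Qed.

Lemma qform_sum I (r : seq I) (p : pred I) (F : I -> 'M[R]_d) v :
  qform (\sum_(i <- r | p i) F i) v = \sum_(i <- r | p i) qform (F i) v.
Proof.
elim/big_rec2: _ => [|i x y _ <-]; last by rewrite qformD.
by rewrite /qform mulmx0 mul0mx mxE.
Qed.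

Lemma qform1 v : qform 1%:M v = (v *m v^T) 0 0.
Proof. by rewrite /qform mulmx1. Qed.

Lemma qform1_sum v : qform 1%:M v = \sum_k v 0 k ^+ 2.
Proof. by rewrite qform1 mxE; apply: eq_bigr => k _; rewrite !mxE expr2. Qed.

Lemma psd1 : psd 1%:M.
Proof. by move=> v; rewrite qform1_sum; apply: sumr_ge0 => k _; exact: sqr_ge0. Qed.

Lemma orthogonal_mxC P : orthogonal_mx P -> P^T *m P = 1%:M.
Proof. exact: mulmx1C. Qed.

Lemma spmx_sym P D : mxsym (spmx P D).
Proof. by rewrite /mxsym /spmx !trmx_mul trmxK tr_diag_mx mulmxA. Qed.

Lemma spmxM P D E : orthogonal_mx P ->
  spmx P D *m spmx P E = spmx P (\row_k (D 0 k * E 0 k)).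
Proof.
move=> oP; rewrite /spmx !mulmxA -(mulmxA _ P) oP mulmx1 -(mulmxA P^T).
by rewrite mulmx_diag.
Qed.

Lemma spmxD P D E : spmx P D + spmx P E = spmx P (D + E).
Proof. by rewrite /spmx raddfD /= mulmxDr mulmxDl. Qed.

Lemma spmxZ P (a : R) D : a *: spmx P D = spmx P (a *: D).
Proof. by rewrite /spmx linearZ /= -scalemxAr -scalemxAl. Qed.

Lemma spmx1 P : orthogonal_mx P -> spmx P (const_mx 1) = 1%:M.
Proof. by move=> oP; rewrite /spmx diag_const_mx mulmx1 orthogonal_mxC. Qed.

Lemma spmx_exp P D m : orthogonal_mx P -> spmx P D ^+ m = spmx P (\row_k (D 0 k ^+ m)).
Proof.
move=> oP; elim: m => [|m IH].
  rewrite expr0 -[1]/(1%:M) -(spmx1 oP); congr spmx.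
  by apply/rowP => k; rewrite !mxE expr0.
rewrite exprS IH -[_ * _]/(_ *m _) spmxM //; congr spmx.
by apply/rowP => k; rewrite !mxE exprS.
Qed.

Lemma mxinner_spmx P D X :
  mxinner (spmx P D) X = \sum_k D 0 k * qform X (row k P).
Proof.
rewrite /mxinner /spmx -!mulmxA mxtrace_mulC mulmxA -!mulmxA /mxtrace.
apply: eq_bigr => k _; rewrite mul_diag_mx mxE; congr (_ * _).
by rewrite mulmxA /qform -row_mul !mxE; apply: eq_bigr => j _; rewrite !mxE.
Qed.

Lemma row_orthogonal P k : orthogonal_mx P -> row k P *m P^T = delta_mx 0 k.
Proof. by move=> oP; rewrite -row_mul oP row1. Qed.

Lemma bilin_spmx P D u v : (u *m spmx P D *m v^T) 0 0 =
  \sum_k D 0 k * ((u *m P^T) 0 k * (v *m P^T) 0 k).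
Proof.
have -> : u *m spmx P D *m v^T = (u *m P^T) *m (diag_mx D *m (v *m P^T)^T).
  by rewrite trmx_mul trmxK /spmx !mulmxA.
rewrite mxE; apply: eq_bigr => k _.
by rewrite mul_diag_mx [in RHS]mulrCA; congr (_ * _); rewrite !mxE.
Qed.

Lemma qform_spmx P D v : qform (spmx P D) v = \sum_k D 0 k * ((v *m P^T) 0 k) ^+ 2.
Proof. by rewrite /qform bilin_spmx; apply: eq_bigr => k _; rewrite expr2. Qed.

Lemma qform_spmx_row P D k : orthogonal_mx P -> qform (spmx P D) (row k P) = D 0 k.
Proof.
move=> oP; rewrite qform_spmx row_orthogonal // (bigD1 k) //= big1 ?addr0.
  by rewrite mxE !eqxx expr1n mulr1.
by move=> j jk; rewrite mxE (negbTE jk) andbF expr0n mulr0.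
Qed.

Lemma qform1_row P k : orthogonal_mx P -> qform 1%:M (row k P) = 1.
Proof. by move=> oP; rewrite -(spmx1 oP) qform_spmx_row // mxE. Qed.

Lemma psd_spmx P D : (forall k, 0 <= D 0 k) -> psd (spmx P D).
Proof.
by move=> D0 v; rewrite qform_spmx; apply: sumr_ge0 => k _; rewrite mulr_ge0 ?sqr_ge0.
Qed.

Lemma sym_spmx A : mxsym A -> exists P D, orthogonal_mx P /\ A = spmx P D.
Proof. by move=> /sym_spectral[P [D [oP ->]]]; exists P, D. Qed.

Lemma psd_spmxP A : mxsym A -> psd A ->
  exists P D, [/\ orthogonal_mx P, A = spmx P D & forall k, 0 <= D 0 k].
Proof.
move=> /sym_spmx[P [D [oP ->]]] pA; exists P, D; split=> // k.
by have := pA (row k P); rewrite qform_spmx_row.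
Qed.

Lemma mxinner_ge0 Y X : mxsym Y -> psd Y -> psd X -> 0 <= mxinner Y X.
Proof.
move=> sY /(psd_spmxP sY)[P [D [oP -> D0]]] pX.
by rewrite mxinner_spmx; apply: sumr_ge0 => k _; rewrite mulr_ge0.
Qed.

Lemma ler_mxinner Y X X' : mxsym Y -> psd Y ->
  (forall v, qform X v <= qform X' v) -> mxinner Y X <= mxinner Y X'.
Proof.
move=> sY pY XX'; rewrite -subr_ge0 -mxinnerBr; apply: mxinner_ge0 => // v.
by rewrite qformB subr_ge0.
Qed.

Lemma mxinner1 Y : mxinner Y 1%:M = \tr Y.
Proof. by rewrite /mxinner mulmx1. Qed.

Lemma mxabs_spmx A : mxsym A ->
  exists P D, [/\ orthogonal_mx P, A = spmx P D & mxabs A = spmx P (map_mx Num.norm D)].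
Proof.
move=> /sym_spectral[P [D [oP defA]]]; rewrite /mxabs.
set U := [set _ | _].
have [|Q [E [oQ -> ->]]] := @xgetPex _ (0 : 'M[R]_d) U; last by exists Q, E.
by exists (spmx P (map_mx Num.norm D)), P, D.
Qed.

Lemma mxabs_sym A : mxsym A -> mxsym (mxabs A).
Proof. by move=> /mxabs_spmx[P [D [_ _ ->]]]; exact: spmx_sym. Qed.

Lemma mxabs_psd A : mxsym A -> psd (mxabs A).
Proof.
by move=> /mxabs_spmx[P [D [_ _ ->]]]; apply: psd_spmx => k; rewrite mxE.
Qed.

(** Applied to |A_i|, this gives the oracle the same error for |A_i| as for A_i. *)
Lemma psd_mxabs A : mxsym A -> psd A -> mxabs A = A.
Proof.
move=> /mxabs_spmx[P [D [oP -> ->]]] pA; congr spmx; apply/rowP => k.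
by rewrite mxE ger0_norm //; have := pA (row k P); rewrite qform_spmx_row.
Qed.

Lemma qform_le_opnorm A v : mxsym A -> psd A ->
  qform A v <= opnorm A * qform 1%:M v.
Proof.
move=> sA pA; rewrite /opnorm psd_mxabs //.
have [P [D [oP -> D0]]] := psd_spmxP sA pA.
rewrite qform_spmx -(spmx1 oP) qform_spmx mulr_sumr; apply: ler_sum => k _.
rewrite [X in _ <= _ * (X * _)]mxE mul1r ler_wpM2r ?sqr_ge0 //.
apply: ub_le_sup; last first.
  apply/eigenvalueP; exists (row k P).
    rewrite /spmx !mulmxA row_orthogonal // -rowE row_diag_mx -scalemxAl.
    by rewrite -rowE.
  apply/eqP => rk; have := qform1_row k oP; rewrite rk /qform !mul0mx mxE.
  by move/esym/eqP; rewrite oner_eq0.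
(* the sum of the nonnegative eigenvalues bounds each of them *)
exists (\sum_j D 0 j) => a /eigenvalueP[u ua u0].
have u1 : 0 < qform 1%:M u by rewrite qform1 sqr_rv_gt0.
have : a * qform 1%:M u <= (\sum_j D 0 j) * qform 1%:M u; last by rewrite ler_pM2r.
have -> : a * qform 1%:M u = qform (spmx P D) u.
  by rewrite qform1 /qform ua -scalemxAl [RHS]mxE.
rewrite qform_spmx -(spmx1 oP) qform_spmx mulr_sumr; apply: ler_sum => j _.
rewrite [X in _ <= _ * (X * _)]mxE mul1r ler_wpM2r ?sqr_ge0 // (bigD1 j) //= lerDl.
by apply: sumr_ge0 => i _.
Qed.

End Basics.

(** * Exponential, Gibbs matrices and the log-partition function *)

Section Exponential.
Variables (R : realType) (d : nat).
Implicit Types (A B X Y S P M H : 'M[R]_d) (D E : 'rV[R]_d) (v u : 'rV[R]_d).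

Lemma spmx_sum P D : spmx P D = \sum_k D 0 k *: ((row k P)^T *m row k P).
Proof.
apply/matrixP => i j; rewrite /spmx summxE -mulmxA mxE; apply: eq_bigr => k _.
rewrite mul_diag_mx !mxE big_ord1 !mxE.
by rewrite mulrCA.
Qed.

(** In an eigenbasis the exponential series is a finite sum of scalar series, one for
    each eigenprojection. *)
Lemma mxexp_spmx P D : orthogonal_mx P -> mxexp (spmx P D) = spmx P (map_mx expR D).
Proof.
move=> oP; rewrite /mxexp; apply/cvg_lim => //.
have -> : series (fun k => k`!%:R^-1 *: spmx P D ^+ k) =
    fun N => \sum_k series (exp_coeff (D 0 k)) N *: ((row k P)^T *m row k P).
  apply/funext => N; rewrite /series /=.
  under eq_bigr => m _ do rewrite spmx_exp // spmx_sum scaler_sumr.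
  rewrite exchange_big /=; apply: eq_bigr => k _; rewrite scaler_suml.
  by apply: eq_bigr => m _; rewrite !mxE scalerA /exp_coeff /= mulrC.
rewrite spmx_sum; under [X in _ --> X]eq_bigr => k _ do rewrite mxE.
apply: cvg_big => [|k _]; first exact: add_continuous.
apply: cvgZr_tmp.
exact: is_cvg_series_exp_coeff.
Qed.
Hypothesis d_gt0 : (0 < d)%N.

Lemma mxexp_sym A : mxsym A -> mxsym (mxexp A).
Proof. by move=> /sym_spmx[P [D [oP ->]]]; rewrite mxexp_spmx //; apply: spmx_sym. Qed.

Lemma mxexp_psd A : mxsym A -> psd (mxexp A).
Proof.
move=> /sym_spmx[P [D [oP ->]]]; rewrite mxexp_spmx //; apply: psd_spmx => k.
by rewrite mxE expR_ge0.
Qed.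

Lemma tr_spmx P D : orthogonal_mx P -> \tr (spmx P D) = \sum_k D 0 k.
Proof.
move=> oP; rewrite -mxinner1 mxinner_spmx; apply: eq_bigr => k _.
by rewrite qform1_row // mulr1.
Qed.

Lemma tr_qform P X : orthogonal_mx P -> \tr X = \sum_k qform X (row k P).
Proof.
move=> oP; rewrite -mxinner1 mxinnerC -(spmx1 oP) mxinner_spmx.
by apply: eq_bigr => k _; rewrite mxE mul1r.
Qed.

Lemma tr_mxexp_gt0 A : mxsym A -> 0 < \tr (mxexp A).
Proof.
move=> /sym_spmx[P [D [oP ->]]]; rewrite mxexp_spmx // tr_spmx //.
rewrite (bigD1 (Ordinal d_gt0)) //= ltr_wpDr ?mxE ?expR_gt0 //.
by apply: sumr_ge0 => k _; rewrite mxE expR_ge0.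
Qed.

Lemma gibbs_spmx P D : orthogonal_mx P ->
  gibbs (spmx P D) = spmx P (\row_k (expR (D 0 k) / \sum_j expR (D 0 j))).
Proof.
move=> oP; rewrite /gibbs mxexp_spmx // tr_spmx // spmxZ; congr spmx.
apply/rowP => k; rewrite !mxE mulrC; congr (_ / _).
by apply: eq_bigr => j _; rewrite mxE.
Qed.

Lemma gibbs_spectraplex A : mxsym A -> spectraplex (gibbs A).
Proof.
move=> sA; have Z0 := tr_mxexp_gt0 sA; split.
- by rewrite /mxsym /gibbs linearZ /= mxexp_sym.
- move=> v; rewrite -/(qform (gibbs A) v) /gibbs qformZ mulr_ge0 ?invr_ge0 ?(ltW Z0) //.
  exact: mxexp_psd.
- by rewrite /gibbs mxtraceZ mulVf // gt_eqF.
Qed.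

(** The graph of exp lies above its tangent at the mean. *)
Lemma expR_jensen (w x : 'I_d -> R) : (forall k, 0 <= w k) -> \sum_k w k = 1 ->
  expR (\sum_k w k * x k) <= \sum_k w k * expR (x k).
Proof.
move=> w0 w1; set m := \sum_k w k * x k.
have -> : expR m = \sum_k w k * (expR m * (1 + (x k - m))).
  under eq_bigr => k _ do rewrite mulrCA.
  rewrite -mulr_sumr; under eq_bigr => k _ do rewrite mulrDr mulr1 mulrBr.
  by rewrite big_split /= w1 sumrB -/m -mulr_suml w1 mul1r subrr addr0 mulr1.
apply: ler_sum => k _; rewrite ler_wpM2l //.
have -> : expR (x k) = expR m * expR (x k - m) by rewrite -expRD addrC subrK.
rewrite ler_wpM2l ?expR_ge0 //.
exact: expR_ge1Dx.
Qed.

Definition logpart M : R := ln (\tr (mxexp M)).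

Lemma sum_sqr_row P v : orthogonal_mx P ->
  \sum_k ((v *m P^T) 0 k) ^+ 2 = qform 1%:M v.
Proof.
by move=> oP; rewrite -(spmx1 oP) qform_spmx; apply: eq_bigr => k _; rewrite [const_mx _ _ _]mxE mul1r.
Qed.

(** Jensen in an eigenbasis of M, with the squared coordinates of v as weights. *)
Lemma expR_qform_le M v : mxsym M -> qform 1%:M v = 1 ->
  expR (qform M v) <= qform (mxexp M) v.
Proof.
move=> /sym_spmx[P [D [oP ->]]] v1; rewrite mxexp_spmx // !qform_spmx.
under eq_bigr => k _ do rewrite mulrC.
apply: (le_trans (expR_jensen _ _ _)); rewrite ?sum_sqr_row //.
  by move=> k; exact: sqr_ge0.
by apply: ler_sum => k _; rewrite [X in _ <= X * _]mxE mulrC.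
Qed.

(** Convexity of Phi, the Peierls-Bogoliubov inequality. Computing the trace of exp H
    in an eigenbasis of M leaves two applications of Jensen: one along each basis
    vector, and one over the basis vectors with the Gibbs weights of M. *)
Lemma logpart_tangent M H : mxsym M -> mxsym H ->
  logpart M + mxinner (gibbs M) (H - M) <= logpart H.
Proof.
move=> sM sH; have ZM := tr_mxexp_gt0 sM; have ZH := tr_mxexp_gt0 sH.
rewrite /logpart -[X in _ + X]expRK -lnM ?posrE ?expR_gt0 //.
rewrite ler_ln ?posrE ?mulr_gt0 ?expR_gt0 //.
have [P [D [oP defM]]] := sym_spmx sM.
have defZ : \tr (mxexp M) = \sum_k expR (D 0 k).
  by rewrite defM mxexp_spmx // tr_spmx //; apply: eq_bigr => k _; rewrite mxE.
rewrite [X in mxinner (gibbs X) _]defM gibbs_spmx // -defZ mxinner_spmx.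
set Z := \tr (mxexp M) in ZM defZ *.
under eq_bigr => k _ do rewrite mxE.
rewrite mulrC -ler_pdivlMr //.
apply: le_trans (expR_jensen _ _ _) _.
- by move=> k; rewrite divr_ge0 ?expR_ge0 // ltW.
- by rewrite -mulr_suml -defZ divff // gt_eqF.
rewrite ler_pdivlMr // mulr_suml (tr_qform _ oP).
apply: ler_sum => k _; rewrite mulrAC divfK ?gt_eqF // -expRD qformB.
rewrite defM qform_spmx_row // addrC subrK.
by apply: expR_qform_le => //; exact: qform1_row.
Qed.

(** This replaces duality with the entropy: the value of the spectraplex player is at
    most the largest eigenvalue of M, and Phi(M) is at least that. *)
Lemma mxinner_le_logpart Y M : spectraplex Y -> mxsym M -> mxinner Y M <= logpart M.
Proof.
move=> [sY pY tY] sM; have ZM := tr_mxexp_gt0 sM.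
rewrite -ler_expR lnK ?posrE //.
have [P [D [oP ->]]] := sym_spmx sM.
rewrite mxexp_spmx // mxinnerC mxinner_spmx.
have Y1 : \sum_k qform Y (row k P) = 1 by rewrite -tr_qform.
under eq_bigr => k _ do rewrite mulrC.
apply: le_trans (expR_jensen _ _ _) _ => //; first by move=> k; exact: pY.
rewrite tr_spmx //; apply: ler_sum => k _; rewrite mxE ler_piMl ?expR_ge0 //.
by rewrite -Y1 (bigD1 k) //= lerDl; apply: sumr_ge0 => j _; exact: pY.
Qed.

Lemma logpart_nonpos M : mxsym M -> psd (- M) -> logpart M <= ln d%:R.
Proof.
move=> sM nM; have ZM := tr_mxexp_gt0 sM.
rewrite ler_ln ?posrE ?ltr0n //.
have [P [D [oP defM]]] := sym_spmx sM; rewrite defM mxexp_spmx // tr_spmx //.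
rewrite -[X in X%:R]card_ord -sum1_card natr_sum; apply: ler_sum => k _.
rewrite mxE -[1%:R]expR0 ler_expR -oppr_ge0.
by have := nM (row k P); rewrite qformN defM qform_spmx_row.
Qed.

End Exponential.

(** * The Golden-Thompson inequality *)

Section GoldenThompson.
Variables (R : realType) (d : nat).
Implicit Types (A B X Y M H P Q : 'M[R]_d) (u v : 'rV[R]_d) (b c t : R).

Lemma tr_mulC A B : \tr (A * B) = \tr (B * A).
Proof. exact: mxtrace_mulC. Qed.

Lemma trmx_mulr A B : (A * B)^T = B^T * A^T.
Proof. exact: trmx_mul. Qed.

Lemma trmx_exp A m : (A ^+ m)^T = A^T ^+ m.
Proof. by elim: m => [|m IH]; rewrite ?expr0 ?trmx1 // exprS exprSr trmx_mulr IH. Qed.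

Lemma mulr_exp_shift A B m : (A * B) ^+ m.+1 = A * (B * A) ^+ m * B.
Proof.
elim: m => [|m IH]; first by rewrite expr1 expr0 mulr1.
by rewrite exprS IH exprS !mulrA.
Qed.

Lemma tr_expC A B m : (0 < m)%N -> \tr ((A * B) ^+ m) = \tr ((B * A) ^+ m).
Proof.
case: m => // m _; rewrite mulr_exp_shift -mulrA tr_mulC -mulrA -exprSr.
by [].
Qed.

Lemma tr_mul_trmx A B : \tr (A * B^T) = \sum_i \sum_j A i j * B i j.
Proof.
rewrite /mxtrace; apply: eq_bigr => i _; rewrite -[A * _]/(A *m _) mxE.
by apply: eq_bigr => j _; rewrite mxE.
Qed.

Lemma tr_mul_le A B : 2 * \tr (A * B^T) <= \tr (A * A^T) + \tr (B * B^T).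
Proof.
rewrite !tr_mul_trmx -big_split /= mulr_sumr; apply: ler_sum => i _.
rewrite -big_split /= mulr_sumr; apply: ler_sum => j _.
have := sqr_ge0 (A i j - B i j); nra.
Qed.

(** The two inequalities are proved together. For the second, one halving by the first
    turns (PQ)^(2^(k+1)) into (P Q Q P)^(2^k), cyclically (P^2 Q^2)^(2^k). For the
    first, the square of X gives X (X X^T) X^T, cyclically a product of the symmetric
    matrices X X^T and X^T X, to which the second and Cauchy-Schwarz apply. *)
Lemma tr_exp2_le k :
  (forall X, \tr (X ^+ (2 ^ k.+1)) <= \tr ((X * X^T) ^+ (2 ^ k))) /\
  (forall P Q, P^T = P -> Q^T = Q ->
     \tr ((P * Q) ^+ (2 ^ k)) <= \tr (P ^+ (2 ^ k) * Q ^+ (2 ^ k))).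
Proof.
have sq X m : X ^+ (2 ^ m.+1) = (X * X) ^+ (2 ^ m) by rewrite expnS exprM expr2.
have pos m : (0 < 2 ^ m)%N by rewrite expn_gt0.
elim: k => [|k [IHa IHb]].
  split=> [X|P Q _ _]; last by rewrite !expr1.
  rewrite sq expn0 !expr1; have := tr_mul_le X X^T.
  rewrite !trmxK (tr_mulC X^T X).
  lra.
split=> [X|P Q sP sQ].
  rewrite sq; apply: le_trans (IHa _) _.
  have -> : X * X * (X * X)^T = X * (X * X^T * X^T) by rewrite trmx_mulr !mulrA.
  rewrite tr_expC // (_ : _ * X = (X * X^T) * (X^T * X)); last by rewrite !mulrA.
  apply: le_trans (IHb _ _ _ _) _; rewrite ?trmx_mulr ?trmxK //.
  have := tr_mul_le ((X * X^T) ^+ (2 ^ k)) ((X^T * X) ^+ (2 ^ k)).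
  rewrite !trmx_exp !trmx_mulr !trmxK -!exprD !addnn -!mul2n -!expnS.
  rewrite (tr_expC X^T X) //; lra.
apply: le_trans (IHa _) _.
rewrite trmx_mulr sP sQ (_ : P * Q * (Q * P) = P * (Q * Q * P)); last by rewrite !mulrA.
rewrite tr_expC // -mulrA (sq P) (sq Q) tr_mulC.
by apply: IHb; rewrite trmx_mulr ?sP ?sQ.
Qed.

Definition norm1 v : R := \sum_j `|v 0 j|.

(** Bounds on the operator norm for the l1 norm of row vectors. Any submultiplicative
    norm for which the identity has norm 1 would do. *)
Definition opbnd X c := forall v, norm1 (v *m X) <= c * norm1 v.

Lemma norm1_ge0 v : 0 <= norm1 v. Proof. exact: sumr_ge0. Qed.

Lemma opbnd1 : opbnd 1 1.
Proof. by move=> v; rewrite mulmx1 mul1r. Qed.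

Lemma opbnd0 : opbnd 0 0.
Proof. by move=> v; rewrite mulmx0 mul0r /norm1 big1 // => j _; rewrite mxE normr0. Qed.

Lemma opbndW X b c : opbnd X b -> b <= c -> opbnd X c.
Proof. by move=> Xb bc v; apply: le_trans (Xb v) _; rewrite ler_wpM2r ?norm1_ge0. Qed.

Lemma opbndD X Y b c : opbnd X b -> opbnd Y c -> opbnd (X + Y) (b + c).
Proof.
move=> Xb Yc v; rewrite mulmxDr mulrDl; apply: le_trans (lerD (Xb v) (Yc v)).
by rewrite /norm1 -big_split /=; apply: ler_sum => j _; rewrite mxE ler_normD.
Qed.

Lemma opbndZ (a : R) X b : opbnd X b -> opbnd (a *: X) (`|a| * b).
Proof.
move=> Xb v; rewrite -scalemxAr -mulrA.
have -> : norm1 (a *: (v *m X)) = `|a| * norm1 (v *m X).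
  by rewrite /norm1 mulr_sumr; apply: eq_bigr => j _; rewrite mxE normrM.
by rewrite ler_wpM2l.
Qed.

Lemma opbndN X b : opbnd X b -> opbnd (- X) b.
Proof. by move=> /(opbndZ (-1)); rewrite scaleN1r normrN1 mul1r. Qed.

Lemma opbndM X Y b c : 0 <= c -> opbnd X b -> opbnd Y c -> opbnd (X * Y) (b * c).
Proof.
move=> c0 Xb Yc v; rewrite -[X * Y]/(X *m Y) mulmxA; apply: le_trans (Yc _) _.
by rewrite -mulrA mulrCA ler_wpM2l.
Qed.

Lemma opbnd_exp X b m : 0 <= b -> opbnd X b -> opbnd (X ^+ m) (b ^+ m).
Proof.
move=> b0 Xb; elim: m => [|m IH]; first exact: opbnd1.
by rewrite !exprS; apply: opbndM => //; exact: exprn_ge0.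
Qed.

Lemma opbnd_entries X : exists2 c, 0 <= c & opbnd X c.
Proof.
exists (\sum_i \sum_j `|X i j|).
  by apply: sumr_ge0 => i _; apply: sumr_ge0.
move=> v; rewrite /norm1.
apply: (@le_trans _ _ (\sum_j \sum_i `|v 0 i| * `|X i j|)).
  apply: ler_sum => j _; rewrite mxE; apply: le_trans (ler_norm_sum _ _ _) _.
  by apply: ler_sum => i _; rewrite normrM.
rewrite exchange_big /= mulr_suml; apply: ler_sum => i _.
rewrite -mulr_sumr mulrC ler_wpM2l ?sumr_ge0 // (bigD1 i) //= lerDl.
exact: sumr_ge0.
Qed.

Lemma tr_opbnd X c : opbnd X c -> `|\tr X| <= d%:R * c.
Proof.
move=> Xc; apply: le_trans (ler_norm_sum _ _ _) _.
rewrite -[X in X%:R]card_ord -sum1_card natr_sum mulr_suml; apply: ler_sum => i _.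
have := Xc (delta_mx 0 i); rewrite -rowE.
have -> : norm1 (delta_mx 0 i) = 1.
  rewrite /norm1 (bigD1 i) //= mxE !eqxx normr1 big1 ?addr0 // => j ji.
  by rewrite mxE (negbTE ji) andbF normr0.
rewrite mulr1 mul1r; apply: le_trans.
by rewrite /norm1 (bigD1 i) //= mxE lerDl sumr_ge0.
Qed.

(** Telescoping X^m - Y^m one factor at a time. *)
Lemma opbnd_subX X Y b e m : 1 <= b -> 0 <= e -> opbnd X b -> opbnd Y b ->
  opbnd (X - Y) e -> opbnd (X ^+ m - Y ^+ m) (m%:R * b ^+ m * e).
Proof.
move=> b1 e0 Xb Yb XYe; have b0 : 0 <= b by apply: le_trans b1.
elim: m => [|m IH]; first by rewrite !expr0 subrr !mul0r; exact: opbnd0.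
have -> : X ^+ m.+1 - Y ^+ m.+1 = (X - Y) * X ^+ m + Y * (X ^+ m - Y ^+ m).
  by rewrite !exprS mulrBl mulrBr addrA subrK.
apply: opbndW (opbndD (opbndM _ XYe (opbnd_exp m b0 Xb)) (opbndM _ Yb IH)) _.
- exact: exprn_ge0.
- by rewrite !mulr_ge0 ?exprn_ge0.
have bm : 0 <= b ^+ m by exact: exprn_ge0.
have -> : m.+1%:R * b ^+ m.+1 * e = b * (m%:R * b ^+ m * e) + b * (e * b ^+ m).
  by rewrite exprS -natr1; ring.
by rewrite addrC lerD2l; apply: ler_peMl => //; exact: mulr_ge0.
Qed.

(** The upper bound comes from exp x <= 1 / (1 - x). *)
Lemma expR_quad (x : R) : `|x| <= 1 / 2 -> `|expR x - 1 - x| <= 2 * x ^+ 2.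
Proof.
rewrite ler_norml => /andP[x1 x2].
have := expR_ge1Dx x; have := expR_ge1Dx (- x); have := expRxMexpNx_1 x.
move: (expR x) (expR (- x)) (expR_gt0 x) => a b a0 ab h1 h2.
rewrite ger0_norm; last by lra.
have : a * (1 - x) <= 1 by rewrite -[leRHS]ab ler_wpM2l ?(ltW a0).
have : 1 <= (1 + x + 2 * x ^+ 2) * (1 - x).
  have -> : (1 + x + 2 * x ^+ 2) * (1 - x) = 1 + x ^+ 2 * (1 - 2 * x) by ring.
  by rewrite lerDl mulr_ge0 ?sqr_ge0 //; lra.
move=> h3 h4; have := le_trans h4 h3; rewrite ler_pM2r; lra.
Qed.

(** Remainder of order two of the exponential, uniform for small t. *)
Lemma mxexp_quad A : mxsym A -> exists2 c, 0 <= c &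
  forall t, 0 <= t -> t * c <= 1 -> opbnd (mxexp (t *: A) - (1 + t *: A)) (c * t ^+ 2).
Proof.
move=> /sym_spmx[P [D [oP ->]]].
have /choice[f fP] : forall k, exists c, 0 <= c /\ opbnd ((row k P)^T *m row k P) c.
  by move=> k; have [c c0 cP] := opbnd_entries ((row k P)^T *m row k P); exists c.
pose c1 := \sum_k 2 * `|D 0 k|.
pose c2 := \sum_k 2 * D 0 k ^+ 2 * f k.
have c1_ge0 : 0 <= c1 by apply: sumr_ge0 => k _; rewrite mulr_ge0.
have c2_ge0 : 0 <= c2.
  apply: sumr_ge0 => k _; apply: mulr_ge0; last by case: (fP k).
  by rewrite mulr_ge0 ?sqr_ge0.
exists (c1 + c2) => [|t t0 tc]; first exact: addr_ge0.
have -> : mxexp (t *: spmx P D) - (1 + t *: spmx P D) =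
    spmx P (\row_k (expR (t * D 0 k) - 1 - t * D 0 k)).
  have -> : 1 = spmx P (const_mx 1) by rewrite spmx1.
  rewrite spmxZ mxexp_spmx // spmxD -[- _]scaleN1r spmxZ spmxD.
  by congr spmx; apply/rowP => k; rewrite !mxE; ring.
apply: (@opbndW _ (c2 * t ^+ 2)); last by rewrite ler_wpM2r ?sqr_ge0 // lerDr.
rewrite spmx_sum mulr_suml.
apply: (big_ind2 opbnd) => [|X b Y e|k _]; [exact: opbnd0|exact: opbndD|].
apply: opbndW (opbndZ _ (proj2 (fP k))) _; rewrite mxE.
rewrite [leRHS]mulrAC ler_wpM2r ?(proj1 (fP k)) //.
apply: le_trans (expR_quad _) _; last by rewrite exprMn mulrA mulrAC.
rewrite normrM ger0_norm //.
have : t * (2 * `|D 0 k|) <= 1; last by lra.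
apply: le_trans tc; rewrite ler_wpM2l // ler_wpDr //.
by rewrite /c1 (bigD1 k) //= lerDl sumr_ge0 // => j _; rewrite mulr_ge0.
Qed.

Lemma mxexpX A (m : nat) : mxsym A -> (0 < m)%N -> mxexp (m%:R^-1 *: A) ^+ m = mxexp A.
Proof.
move=> /sym_spmx[P [D [oP ->]]] m0; rewrite spmxZ !mxexp_spmx // spmx_exp //.
congr spmx; apply/rowP => k; rewrite !mxE -expRM_natl mulrA mulfV ?mul1r //.
by rewrite pnatr_eq0 -lt0n.
Qed.

(** Lie product formula with a rate, under the trace and in one direction only: the
    steps exp((H + M)/m) and exp(H/m) exp(M/m) differ by O(1/m^2), and both have norm
    at most exp(4 C/m), so that their m-th powers differ by O(1/m). *)
Lemma lie_trotter_tr H M : mxsym H -> mxsym M -> exists2 K, 0 <= K &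
  forall m : nat, (0 < m)%N -> K <= m%:R ->
  \tr (mxexp (H + M)) <=
  \tr ((mxexp (m%:R^-1 *: H) * mxexp (m%:R^-1 *: M)) ^+ m) + K / m%:R.
Proof.
move=> sH sM; have sS : mxsym (H + M) by rewrite /mxsym linearD /= sH sM.
have [cH cH0 qH] := mxexp_quad sH; have [cM cM0 qM] := mxexp_quad sM.
have [cS cS0 qS] := mxexp_quad sS.
have [bH bH0 eH] := opbnd_entries H; have [bM bM0 eM] := opbnd_entries M.
pose C := 1 + (cH + cM + cS + bH + bM).
have C1 : 1 <= C by rewrite lerDl !addr_ge0.
have C0 : 0 <= C by apply: le_trans C1.
pose K := d%:R * (expR (4 * C) * (7 * C ^+ 2)).
have K0 : 0 <= K by rewrite !mulr_ge0 ?expR_ge0 ?exprn_ge0.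
exists (C + K) => [|m m0 Km]; first exact: addr_ge0.
have m1 : 0 < m%:R :> R by rewrite ltr0n.
pose t := m%:R^-1 : R; have t0 : 0 <= t by rewrite invr_ge0 ltW.
pose s := t * C; have s0 : 0 <= s by rewrite mulr_ge0.
have s1 : s <= 1.
  rewrite /s /t mulrC ler_pdivrMr // mul1r; apply: le_trans Km.
  by rewrite lerDl.
have small c : 0 <= c -> c <= C -> t * c <= 1.
  by move=> c0 cC; apply: le_trans s1; rewrite ler_wpM2l.
have smallq c X : 0 <= c -> c <= C -> opbnd X (c * t ^+ 2) -> opbnd X (s ^+ 2).
  move=> c0 cC Xb; apply: opbndW Xb _; rewrite /s exprMn mulrC ler_wpM2l ?sqr_ge0 //.
  by apply: le_trans cC _; rewrite expr2 ler_peMl.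
have RH : opbnd (mxexp (t *: H) - (1 + t *: H)) (s ^+ 2).
  by apply: smallq cH0 _ (qH _ t0 (small _ cH0 _)); rewrite /C; lra.
have RM : opbnd (mxexp (t *: M) - (1 + t *: M)) (s ^+ 2).
  by apply: smallq cM0 _ (qM _ t0 (small _ cM0 _)); rewrite /C; lra.
have RS : opbnd (mxexp (t *: (H + M)) - (1 + t *: (H + M))) (s ^+ 2).
  by apply: smallq cS0 _ (qS _ t0 (small _ cS0 _)); rewrite /C; lra.
have BS : opbnd (t *: (H + M)) s.
  apply: opbndW (opbndZ t (opbndD eH eM)) _; rewrite ger0_norm // ler_wpM2l //.
  by rewrite /C; lra.
have BH : opbnd (t *: H) s.
  by apply: opbndW (opbndZ t eH) _; rewrite ger0_norm // ler_wpM2l // /C; lra.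
have BM : opbnd (t *: M) s.
  by apply: opbndW (opbndZ t eM) _; rewrite ger0_norm // ler_wpM2l // /C; lra.
have expb X (E : 'M[R]_d) : opbnd X s -> opbnd (E - (1 + X)) (s ^+ 2) -> opbnd E (1 + 2 * s).
  move=> BX RX; rewrite -(subrK (1 + X) E).
  apply: opbndW (opbndD RX (opbndD opbnd1 BX)) _.
  by have : s ^+ 2 <= s by [rewrite expr2 ler_piMl]; lra.
have ES := expb _ _ BS RS; have EH := expb _ _ BH RH; have EM := expb _ _ BM RM.
set X := mxexp (t *: (H + M)) in RS ES.
set U := mxexp (t *: H) in RH EH *; set V := mxexp (t *: M) in RM EM *.
have XY : opbnd (X - U * V) (7 * s ^+ 2).
  have -> : X - U * V = (X - (1 + t *: (H + M))) - (t *: H) * (t *: M)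
      - (1 + t *: H) * (V - (1 + t *: M)) - (U - (1 + t *: H)) * V.
    rewrite scalerDr; move: (t *: H) (t *: M) => h k.
    have -> : (1 + h) * (V - (1 + k)) = (1 + h) * V - ((1 + k) + (h + h * k)).
      by rewrite mulrBr mulrDl mul1r (mulrDl 1 h (1 + k)) mul1r (mulrDr h) mulr1.
    rewrite (mulrBl V).
    move: ((1 + h) * V) (U * V) (h * k) (1 : 'M[R]_d) => p q r e.
    by apply/matrixP => i j; rewrite !mxE; ring.
  have s20 : 0 <= s ^+ 2 by exact: exprn_ge0.
  have s21 : 0 <= 1 + 2 * s by lra.
  apply: opbndW (opbndD (opbndD (opbndD RS (opbndN (opbndM s0 BH BM)))
    (opbndN (opbndM s20 (opbndD opbnd1 BH) RM))) (opbndN (opbndM s21 RH EM))) _.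
  have : s ^+ 2 * s <= s ^+ 2 by rewrite ler_piMr.
  by rewrite -expr2; lra.
have b1 : 1 + 2 * s <= expR (4 * s).
  by apply: le_trans (expR_ge1Dx _) _; rewrite ler_expR; lra.
have b2 : (1 + 2 * s) * (1 + 2 * s) <= expR (4 * s).
  have -> : 4 * s = 2 * s + 2 * s by ring.
  have h : 1 + 2 * s <= expR (2 * s) by exact: expR_ge1Dx.
  by rewrite expRD; apply: ler_pM => //; lra.
have s21 : 0 <= 1 + 2 * s by lra.
have tr1 := tr_opbnd (opbnd_subX m _ _ (opbndW ES b1) (opbndW (opbndM s21 EH EM) b2) XY).
have {}tr1 : `|\tr (X ^+ m - (U * V) ^+ m)| <= K / m%:R.
  apply: le_trans (tr1 _ _) _; first by rewrite -[leLHS]expR0 ler_expR mulr_ge0.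
    by rewrite mulr_ge0 ?exprn_ge0.
  rewrite -expRM_natl.
  have -> : m%:R * (4 * s) = 4 * C by rewrite /s /t; field; rewrite gt_eqF.
  rewrite /K -[X in _ <= X]mulrA ler_wpM2l // /s /t le_eqVlt; apply/orP; left; apply/eqP.
  by field; rewrite gt_eqF.
have defX : X ^+ m = mxexp (H + M) by exact: mxexpX.
move: tr1; rewrite linearB /= defX ler_norml => /andP[_].
have : K / m%:R <= (C + K) / m%:R by rewrite ler_wpM2r // lerDr.
lra.
Qed.

(** By tr_exp2_le the trace of the Lie product with 2^k factors is at most the
    right-hand side, for every k. *)
Lemma golden_thompson H M : mxsym H -> mxsym M ->
  \tr (mxexp (H + M)) <= \tr (mxexp H * mxexp M).
Proof.
move=> sH sM; have [K K0 lie] := lie_trotter_tr sH sM.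
have symZ A a : mxsym A -> mxsym (a *: A) by move=> sA; rewrite /mxsym linearZ /= sA.
apply/ler_addgt0Pr => e e0.
have [k [k0 kK]] : exists k : nat, (0 < k)%N /\ K + K / e <= k%:R.
  exists (Num.truncn (K + K / e)).+1; split => //; apply/ltW/truncnS_gt.
have kn : k%:R <= (2 ^ k)%:R :> R by rewrite ler_nat ltnW // ltn_expl.
have K1 : K <= k%:R by apply: le_trans kK; rewrite lerDl divr_ge0 // ltW.
have K2 : K / e <= k%:R by apply: le_trans kK; rewrite lerDr.
have n0 : (0 < 2 ^ k)%N by rewrite expn_gt0.
have := lie _ n0 (le_trans K1 kn); set n := (2 ^ k)%N in kn n0 *.
move/le_trans; apply; apply: lerD; last first.
  rewrite ler_pdivrMr ?ltr0n // mulrC -ler_pdivrMr //; exact: le_trans kn.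
have [_ gt] := tr_exp2_le k; apply: le_trans (gt _ _ _ _) _.
- exact/mxexp_sym/symZ.
- exact/mxexp_sym/symZ.
- by rewrite !mxexpX.
Qed.

(** Golden-Thompson, then exp H <= 1 + H + 2 H^2 as operators, then ln (1 + z) <= z. *)
Lemma logpart_smooth M H : (0 < d)%N -> mxsym M -> mxsym H ->
  (forall v, `|qform H v| <= 1 / 2 * qform 1%:M v) ->
  logpart (M + H) <= logpart M + mxinner (gibbs M) H
                     + 2 * mxinner (gibbs M) (H *m H).
Proof.
move=> d0 sM sH smallH; have ZM := tr_mxexp_gt0 d0 sM.
have sMH : mxsym (M + H) by rewrite /mxsym linearD /= sM sH.
have quadH v : qform (mxexp H) v <= qform (1%:M + H + 2 *: (H *m H)) v.
  move: smallH; have [P [D [oP ->]]] := sym_spmx sH => smallH.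
  rewrite spmxM // spmxZ -(spmx1 oP) !spmxD mxexp_spmx // !qform_spmx.
  apply: ler_sum => k _; rewrite ler_wpM2r ?sqr_ge0 // !mxE.
  have := smallH (row k P); rewrite qform_spmx_row // qform1_row // mulr1.
  by move/expR_quad; rewrite ler_norml expr2 => /andP[_]; lra.
have trle : \tr (mxexp (M + H)) <= \tr (mxexp M) *
    (1 + (mxinner (gibbs M) H + 2 * mxinner (gibbs M) (H *m H))).
  apply: le_trans (golden_thompson sM sH) _.
  apply: (@le_trans _ _ (mxinner (mxexp M) (1%:M + H + 2 *: (H *m H)))).
    by apply: ler_mxinner => //; [exact: mxexp_sym|exact: mxexp_psd].
  have gE X : mxinner (gibbs M) X = (\tr (mxexp M))^-1 * mxinner (mxexp M) X.
    by rewrite mxinnerC mxinnerZr mxinnerC.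
  rewrite !gE !mxinnerDr mxinnerZr mxinner1 le_eqVlt; apply/orP; left; apply/eqP.
  by field; rewrite gt_eqF.
have pos : 0 < 1 + (mxinner (gibbs M) H + 2 * mxinner (gibbs M) (H *m H)).
  by rewrite -(pmulr_rgt0 _ ZM); apply: lt_le_trans trle; exact: tr_mxexp_gt0.
rewrite /logpart -addrA; set z := (X in 1 + X) in trle pos *.
apply: (@le_trans _ _ (ln (\tr (mxexp M) * (1 + z)))).
  by rewrite ler_ln // ?posrE ?mulr_gt0 // tr_mxexp_gt0.
rewrite lnM ?posrE // lerD2l; apply: le_ln1Dx.
by rewrite -subr_gt0 opprK addrC.
Qed.

End GoldenThompson.

(** * The family A_i and its absolute values *)

Section Family.
Variables (R : realType) (n d : nat) (A : 'I_n -> 'M[R]_d).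
Hypothesis symA : forall i, mxsym (A i).
Implicit Types (x y h k q : 'cV[R]_n) (u v : 'rV[R]_d) (E Y : 'M[R]_d).

Local Notation absA := (mxabs_family A).
Local Notation L := (family_norm A).

Lemma lincombD (F : 'I_n -> 'M[R]_d) x y : lincomb F (x + y) = lincomb F x + lincomb F y.
Proof.
by rewrite /lincomb -big_split; apply: eq_bigr => i _; rewrite mxE scalerDl.
Qed.

Lemma lincombZ (F : 'I_n -> 'M[R]_d) (a : R) x : lincomb F (a *: x) = a *: lincomb F x.
Proof.
by rewrite /lincomb scaler_sumr; apply: eq_bigr => i _; rewrite mxE scalerA.
Qed.

Lemma lincombN (F : 'I_n -> 'M[R]_d) x : lincomb F (- x) = - lincomb F x.
Proof. by rewrite -scaleN1r lincombZ scaleN1r. Qed.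

Lemma lincombB (F : 'I_n -> 'M[R]_d) x y : lincomb F (x - y) = lincomb F x - lincomb F y.
Proof. by rewrite lincombD lincombN. Qed.

Lemma lincomb0 (F : 'I_n -> 'M[R]_d) : lincomb F 0 = 0.
Proof. by rewrite -(scale0r 0) lincombZ scale0r. Qed.

Lemma mxsymD (X Y : 'M[R]_d) : mxsym X -> mxsym Y -> mxsym (X + Y).
Proof. by rewrite /mxsym linearD /= => -> ->. Qed.

Lemma mxsymZ (a : R) (X : 'M[R]_d) : mxsym X -> mxsym (a *: X).
Proof. by rewrite /mxsym linearZ /= => ->. Qed.

Lemma mxsymN (X : 'M[R]_d) : mxsym X -> mxsym (- X).
Proof. by rewrite /mxsym linearN /= => ->. Qed.

Lemma mxsym_lincomb (F : 'I_n -> 'M[R]_d) x :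
  (forall i, mxsym (F i)) -> mxsym (lincomb F x).
Proof.
move=> sF; rewrite /lincomb; apply: (big_ind (@mxsym _ _)) => [||i _].
- exact: trmx0.
- exact: mxsymD.
- exact/mxsymZ.
Qed.

Lemma symabs i : mxsym (absA i). Proof. exact: mxabs_sym. Qed.

Lemma psd_lincomb_abs x : (forall i, 0 <= x i 0) -> psd (lincomb absA x).
Proof.
move=> x0 v; rewrite /lincomb qform_sum; apply: sumr_ge0 => i _.
by rewrite qformZ mulr_ge0 // mxabs_psd.
Qed.

Lemma sum_abs_sym : mxsym (\sum_i mxabs (A i)).
Proof.
apply: (big_ind (@mxsym _ _)) => [||i _]; [exact: trmx0|exact: mxsymD|exact: symabs].
Qed.

Lemma sum_abs_psd : psd (\sum_i mxabs (A i)).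
Proof.
by move=> v; rewrite qform_sum; apply: sumr_ge0 => i _; apply: mxabs_psd.
Qed.

Lemma sum_abs_le v : \sum_i qform (mxabs (A i)) v <= L * qform 1%:M v.
Proof.
by rewrite -qform_sum; apply: qform_le_opnorm; [exact: sum_abs_sym|exact: sum_abs_psd].
Qed.

Lemma sum_abs_inner Y : spectraplex Y -> \sum_i mxinner Y (mxabs (A i)) <= L.
Proof.
move=> [sY pY tY]; rewrite -mxinner_sumr.
have -> : L = mxinner Y (L *: 1%:M) by rewrite mxinnerZr mxinner1 tY mulr1.
apply: ler_mxinner => // v; rewrite qform_sum qformZ; exact: sum_abs_le.
Qed.

Lemma sum_abs_tr : \sum_i \tr (mxabs (A i)) <= L * d%:R.
Proof.
have -> : \sum_i \tr (mxabs (A i)) = mxinner 1%:M (\sum_i mxabs (A i)).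
  by rewrite mxinnerC mxinner1 raddf_sum.
have -> : L * d%:R = mxinner (1%:M : 'M[R]_d) (L *: 1%:M).
  by rewrite mxinnerZr mxinner1; rewrite mxtrace1.
apply: ler_mxinner => [||v]; [exact: trmx1|exact: psd1|].
rewrite qform_sum qformZ; exact: sum_abs_le.
Qed.

(** In an eigenbasis of A_i both A_i and |A_i| are diagonal, and the inequality is
    2 p s t <= s^2 / r + r p^2 t^2 for each eigenvalue, where p = a sg + b with sg the
    sign of that eigenvalue. *)
Lemma abs_bilin_le i (a b q r : R) u v : `|a| + `|b| <= q -> 0 < r ->
  2 * (u *m (a *: A i + b *: mxabs (A i)) *m v^T) 0 0 <=
  r^-1 * qform (mxabs (A i)) u + r * (q ^+ 2 * qform (mxabs (A i)) v).
Proof.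
move=> abq r0; have [P [D [oP defA ->]]] := mxabs_spmx (symA i).
rewrite {1}defA !spmxZ spmxD bilin_spmx !qform_spmx !mulr_sumr -big_split /=.
apply: ler_sum => k _; rewrite !mxE; set s := \sum_j _; set t := \sum_j _.
set D0 := D 0 k; pose p := a * Num.sg D0 + b.
have pq : p ^+ 2 <= q ^+ 2.
  have q0 : 0 <= q by apply: le_trans abq; rewrite addr_ge0.
  rewrite -ler_sqrt ?sqr_ge0 // !sqrtr_sqr (ger0_norm q0).
  apply: le_trans abq; apply: le_trans (ler_normD _ _) _; rewrite lerD2r normrM.
  by rewrite ler_piMr // normr_sg; case: (D0 != 0).
have -> : a * D0 + b * `|D0| = `|D0| * p by rewrite {1}(numEsg D0) /p; ring.
have h : 2 * p * (s * t) <= r^-1 * s ^+ 2 + r * (q ^+ 2 * t ^+ 2).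
  apply: (@le_trans _ _ (r^-1 * s ^+ 2 + r * (p ^+ 2 * t ^+ 2))); last first.
    by rewrite lerD2l ler_wpM2l ?(ltW r0) // ler_wpM2r ?sqr_ge0.
  rewrite -subr_ge0 (_ : _ - _ = r^-1 * (s - r * p * t) ^+ 2).
    by rewrite mulr_ge0 ?sqr_ge0 // invr_ge0 ltW.
  by field; rewrite gt_eqF.
have := ler_wpM2l (normr_ge0 D0) h.
by congr (_ <= _); ring.
Qed.

(** Operator form of the inequality of Cauchy-Schwarz, E^2 <= L |A|(q^2). With u = v E
    one has |u|^2 = u E v^T; splitting each summand by abs_bilin_le with weight r = L
    leaves half of |u|^2 on the right-hand side, because the sum of the |A_i| is at
    most L. *)
Lemma fam_sq_le h k q E v : 0 < L -> (forall i, `|h i 0| + `|k i 0| <= q i 0) ->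
  E = lincomb A h + lincomb absA k ->
  qform (E *m E) v <= L * qform (lincomb absA (\col_i q i 0 ^+ 2)) v.
Proof.
move=> L0 hkq defE.
have sE : E^T = E by rewrite defE; apply: mxsymD; apply: mxsym_lincomb => // i; exact: symabs.
pose u := v *m E.
have -> : qform (E *m E) v = qform 1%:M u.
  by rewrite qform1 /u trmx_mul sE /qform !mulmxA.
have uE : qform 1%:M u = \sum_i (u *m (h i 0 *: A i + k i 0 *: mxabs (A i)) *m v^T) 0 0.
  rewrite qform1 {2}/u trmx_mul sE mulmxA defE /lincomb -big_split /=.
  by rewrite mulmx_sumr mulmx_suml summxE.
have : 2 * qform 1%:M u <= L^-1 * (L * qform 1%:M u)
    + L * qform (lincomb absA (\col_i q i 0 ^+ 2)) v.
  rewrite {1}uE mulr_sumr.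
  apply: (@le_trans _ _ (\sum_i (L^-1 * qform (mxabs (A i)) u +
      L * (q i 0 ^+ 2 * qform (mxabs (A i)) v)))).
    by apply: ler_sum => i _; apply: abs_bilin_le; first exact: hkq.
  rewrite big_split /= -!mulr_sumr; apply: lerD.
    by rewrite ler_wpM2l ?invr_ge0 ?(ltW L0) // sum_abs_le.
  rewrite /lincomb qform_sum ler_wpM2l ?(ltW L0) //; apply: ler_sum => i _.
  by rewrite qformZ mxE.
rewrite mulrA mulVf ?gt_eqF // mul1r; lra.
Qed.

Lemma abs_qform_le i v : `|qform (A i) v| <= qform (mxabs (A i)) v.
Proof.
have [P [D [oP defA ->]]] := mxabs_spmx (symA i); rewrite defA !qform_spmx.
apply: le_trans (ler_norm_sum _ _ _) _; apply: ler_sum => k _.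
by rewrite normrM (ger0_norm (sqr_ge0 _)) [map_mx _ _ _ _]mxE.
Qed.

Lemma fam_small h k (b : R) v : 0 <= b -> (forall i, `|h i 0| + `|k i 0| <= b) ->
  `|qform (lincomb A h + lincomb absA k) v| <= b * (L * qform 1%:M v).
Proof.
move=> b0 hkb; apply: le_trans (ler_wpM2l b0 (sum_abs_le v)).
rewrite /lincomb -big_split qform_sum mulr_sumr /=.
apply: le_trans (ler_norm_sum _ _ _) _; apply: ler_sum => i _.
have pA := mxabs_psd (symA i) v.
apply: le_trans (ler_wpM2r pA (hkb i)); rewrite qformD !qformZ mulrDl.
apply: le_trans (ler_normD _ _) _; rewrite !normrM; apply: lerD.
  by rewrite ler_wpM2l // abs_qform_le.
by rewrite (ger0_norm pA).
Qed.

End Family.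

(** * One round of the potential argument *)

Section Step.
Variables (R : realType) (n d : nat) (A : 'I_n -> 'M[R]_d) (B : 'M[R]_d).
Hypothesis d_gt0 : (0 < d)%N.
Hypothesis symA : forall i, mxsym (A i).
Hypothesis symB : mxsym B.
Implicit Types (x y : 'cV[R]_n) (Y Z : 'M[R]_d).

Local Notation absA := (mxabs_family A).
Local Notation L := (family_norm A).

Definition sqv x : 'cV[R]_n := \col_i x i 0 ^+ 2.

Definition quad x : 'M[R]_d := lincomb absA (sqv x).

(** Argument of the potential after the plays that Z accounts for, x being the last of
    them and y the one to come. Subtracting Q(y) is what the regularizer does; adding
    Q(y - x)/2 keeps in store the cost of the movement that the next prediction will
    get wrong. *)
Definition lookahead Z x y : 'M[R]_d := Z - quad y + 2^-1 *: quad (y - x).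

Lemma mxinner_lincomb Y (F : 'I_n -> 'M[R]_d) x :
  mxinner Y (lincomb F x) = \sum_i x i 0 * mxinner Y (F i).
Proof. by rewrite mxinner_sumr; apply: eq_bigr => i _; rewrite mxinnerZr. Qed.

Lemma quad_sym x : mxsym (quad x).
Proof. by apply: mxsym_lincomb => i; apply: symabs. Qed.

Lemma quad_psd x : psd (quad x).
Proof. by apply: psd_lincomb_abs => // i; rewrite mxE sqr_ge0. Qed.

Lemma lookahead_sym Z x y : mxsym Z -> mxsym (lookahead Z x y).
Proof.
by move=> sZ; do ?[apply: mxsymD|apply: mxsymN|apply: mxsymZ] => //; exact: quad_sym.
Qed.

(** The constant makes the quadratic error 36 L / alpha of a round equal to 1/4 of the
    movement terms. *)
Definition smoothing : R := 144 * L.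
Local Notation alpha := smoothing.

(** Both values of the potential are compared with alpha Phi at the query that defines
    Y: the new one from above by logpart_smooth, the old one from below by
    logpart_tangent. The quadratic error, at most a quarter of <Y, Q(x1 - x0)> +
    <Y, Q(x2 - x1)>, is absorbed: the old potential supplies -1/2 of the first term,
    and the new one uses up only 1/2 of the second. *)
Lemma potential_step Z x0 x1 x2 Y :
  Y = gibbs (alpha^-1 *: (Z + (lincomb A x0 - B) - quad x0)) ->
  0 < L -> mxsym Z -> box x0 -> box x1 -> box x2 ->
  alpha * logpart (alpha^-1 *: lookahead (Z + (lincomb A x1 - B)) x1 x2) <=
  alpha * logpart (alpha^-1 *: lookahead Z x0 x1) + mxinner Y (lincomb A x1 - B)
  + mxinner Y (quad x1 - quad x2 + quad (x2 - x1)).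
Proof.
move=> defY L0 sZ bx0 bx1 bx2; have a0 : 0 < alpha by rewrite mulr_gt0.
set Shat := Z + _ - _ in defY.
have sAx x : mxsym (lincomb A x) by exact: mxsym_lincomb.
have sSh : mxsym Shat.
  by do ?[apply: mxsymD|apply: mxsymN] => //; exact: quad_sym.
have [sY pY tY] : spectraplex Y by rewrite defY; apply: gibbs_spectraplex => //; exact: mxsymZ.
pose k := 2^-1 *: sqv (x2 - x1) - sqv x2 + sqv x0.
pose E := lincomb A (x1 - x0) + lincomb absA k.
have defE : lookahead (Z + (lincomb A x1 - B)) x1 x2 = Shat + E.
  rewrite /lookahead /Shat /E /k lincombB !lincombD lincombN lincombZ -!/(quad _).
  by apply/matrixP => i j; rewrite !mxE; ring.
pose q : 'cV[R]_n := \col_i (3 * (`|x1 i 0 - x0 i 0| + `|x2 i 0 - x1 i 0|)).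
(* the increment E moves A by h and |A| by k, and q dominates both, to first order in
   the two movements *)
have hkq i : `|(x1 - x0) i 0| + `|k i 0| <= q i 0.
  rewrite !mxE; move: (bx0 i) (bx1 i) (bx2 i).
  move: (x0 i 0) (x1 i 0) (x2 i 0) => a b c.
  move=> /andP[a1 a2] /andP[b1 b2] /andP[c1 c2].
  have -> : 2^-1 * (c - b) ^+ 2 - c ^+ 2 + a ^+ 2 =
    2^-1 * (c - b) * (c - b) - (c + a) * (c - b) - (c + a) * (b - a) by field.
  have h1 : `|2^-1 * (c - b) * (c - b)| <= 1 * `|c - b|.
    by rewrite normrM ler_wpM2r // ler_norml; apply/andP; split; lra.
  have h2 : `|(c + a) * (c - b)| <= 2 * `|c - b|.
    by rewrite normrM ler_wpM2r // ler_norml; apply/andP; split; lra.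
  have h3 : `|(c + a) * (b - a)| <= 2 * `|b - a|.
    by rewrite normrM ler_wpM2r // ler_norml; apply/andP; split; lra.
  move: h1 h2 h3; set e1 := 2^-1 * _ * _; set e2 := (c + a) * (c - b).
  set e3 := (c + a) * (b - a) => h1 h2 h3.
  have := ler_normB (e1 - e2) e3; have := ler_normB e1 e2; lra.
(* hence E / alpha is small: 12 L / alpha = 1/12 *)
have q12 i : q i 0 <= 12.
  rewrite !mxE; move: (bx0 i) (bx1 i) (bx2 i).
  move: (x0 i 0) (x1 i 0) (x2 i 0) => a b c.
  move=> /andP[a1 a2] /andP[b1 b2] /andP[c1 c2].
  have h1 : `|b - a| <= 2 by rewrite ler_norml; apply/andP; split; lra.
  have h2 : `|c - b| <= 2 by rewrite ler_norml; apply/andP; split; lra.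
  lra.
have sE : mxsym E by apply: mxsymD => //; apply: mxsym_lincomb => i; exact: symabs.
have small v : `|qform (alpha^-1 *: E) v| <= 1 / 2 * qform 1%:M v.
  have := @fam_small _ _ _ _ symA (x1 - x0) k 12 v (ler0n _ 12)
    (fun i => le_trans (hkq i) (q12 i)).
  rewrite -/E qformZ normrM (gtr0_norm (x := alpha^-1)) ?invr_gt0 //.
  rewrite -(ler_pM2l (x := alpha^-1)) ?invr_gt0 // => /le_trans; apply.
  have -> : alpha^-1 * (12 * (L * qform 1%:M v)) = 1 / 12 * qform 1%:M v.
    by rewrite /smoothing; field; rewrite gt_eqF.
  by rewrite ler_wpM2r ?psd1 //; lra.
have EE : mxinner Y (E *m E) <= 18 * L * (mxinner Y (quad (x1 - x0)) + mxinner Y (quad (x2 - x1))).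
  rewrite -mxinnerDr -mxinnerZr; apply: ler_mxinner => // v.
  apply: le_trans (fam_sq_le symA v L0 hkq erefl) _.
  rewrite qformZ (mulrC 18) -mulrA ler_wpM2l ?(ltW L0) // /quad -lincombD -qformZ -lincombZ.
  rewrite -subr_ge0 -qformB -lincombB; apply: psd_lincomb_abs => // i; rewrite !mxE.
  rewrite exprMn; set a := x1 i 0 - x0 i 0; set b := x2 i 0 - x1 i 0.
  rewrite -(real_normK (num_real a)) -(real_normK (num_real b)).
  by have := sqr_ge0 (`|a| - `|b|); nra.
have := logpart_smooth d_gt0 (mxsymZ alpha^-1 sSh) (mxsymZ alpha^-1 sE) small.
rewrite -scalerDr -defE -defY -scalemxAr -scalemxAl !mxinnerZr => up.
have := logpart_tangent d_gt0 (mxsymZ alpha^-1 sSh)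
  (mxsymZ alpha^-1 (lookahead_sym x0 x1 sZ)).
rewrite -defY -scalerBr mxinnerZr => low.
have N1 := mxinner_ge0 sY pY (quad_psd (x1 - x0)).
have N2 := mxinner_ge0 sY pY (quad_psd (x2 - x1)).
have {}up : alpha * logpart (alpha^-1 *: lookahead (Z + (lincomb A x1 - B)) x1 x2) <=
  alpha * logpart (alpha^-1 *: Shat) + mxinner Y E +
  4^-1 * (mxinner Y (quad (x1 - x0)) + mxinner Y (quad (x2 - x1))).
  apply: le_trans (ler_wpM2l (ltW a0) up) _; rewrite !mulrDr !mulrA divff ?gt_eqF //.
  rewrite mul1r lerD2l -mulrDr.
  have -> : 4^-1 * (mxinner Y (quad (x1 - x0)) + mxinner Y (quad (x2 - x1))) =
    alpha * 2 / alpha / alpha * (18 * L * (mxinner Y (quad (x1 - x0)) + mxinner Y (quad (x2 - x1)))).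
    by rewrite /smoothing; field; rewrite gt_eqF.
  by rewrite ler_wpM2l // !mulr_ge0 ?invr_ge0 // ltW.
have {}low := ler_wpM2l (ltW a0) low.
rewrite mulrDr mulrA divff ?gt_eqF // mul1r in low.
have defEd : E = lookahead Z x0 x1 - Shat + ((lincomb A x1 - B) + (quad x1 - quad x2)
   + 2^-1 *: quad (x2 - x1) - 2^-1 *: quad (x1 - x0)).
  have -> : E = lookahead (Z + (lincomb A x1 - B)) x1 x2 - Shat by rewrite defE addrAC subrr add0r.
  by rewrite /lookahead; apply/matrixP => i j; rewrite !mxE; ring.
have {defEd}defEd : mxinner Y E = mxinner Y (lookahead Z x0 x1 - Shat)
    + (mxinner Y (lincomb A x1 - B) + mxinner Y (quad x1 - quad x2)
       + 2^-1 * mxinner Y (quad (x2 - x1)) - 2^-1 * mxinner Y (quad (x1 - x0))).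
  by rewrite {1}defEd !(mxinnerDr, mxinnerNr, mxinnerZr).
have arith (p q0 r e l n1 n2 a c : R) : p <= r + e + 4^-1 * (n1 + n2) -> r + l <= q0 ->
    e = l + (a + c + 2^-1 * n2 - 2^-1 * n1) -> 0 <= n1 -> 0 <= n2 ->
    p <= q0 + a + (c + n2).
  by clear; lra.
rewrite [mxinner Y (_ - _ + _)]mxinnerDr.
exact: arith up low defEd N1 N2.
Qed.

Lemma lookahead0_nonpos y : psd (- lookahead 0 0 y).
Proof.
move=> v; rewrite /lookahead subr0 sub0r qformN qformD qformN qformZ.
by have := quad_psd y v; lra.
Qed.

End Step.

(** * The algorithm and its invariants *)

Section Solver.
Variables (R : realType) (n : nat).
Implicit Types (x y c : 'cV[R]_n).

Definition dot x y : R := \sum_i x i 0 * y i 0.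

Lemma dotDl x x' y : dot (x + x') y = dot x y + dot x' y.
Proof.
by rewrite /dot -big_split /=; apply: eq_bigr => i _; rewrite mxE mulrDl.
Qed.

Lemma dotDr x y y' : dot x (y + y') = dot x y + dot x y'.
Proof.
by rewrite /dot -big_split /=; apply: eq_bigr => i _; rewrite mxE mulrDr.
Qed.

Lemma dotBr x y y' : dot x (y - y') = dot x y - dot x y'.
Proof.
by rewrite /dot -sumrB /=; apply: eq_bigr => i _; rewrite !mxE mulrBr.
Qed.

(** The minimiser of g x + a x^2 over [-1, 1]. If a = 0 = g, the last branch divides by
    zero and returns 0, which is then a minimiser as well. *)
Definition box_argmin (g a : R) : R :=
  if 2 * a < g then -1 else if g < - (2 * a) then 1 else - g / (2 * a).

Lemma box_argmin_bound (g a : R) : 0 <= a -> -1 <= box_argmin g a <= 1.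
Proof.
rewrite /box_argmin le_eqVlt => /predU1P[<-|a0].
  rewrite !mulr0 oppr0 invr0 mulr0; case: ifP => _; first by lra.
  by case: ifP => _; lra.
case: ltP => [_|h1]; first by lra.
case: ltP => [_|h2]; first by lra.
by rewrite ler_pdivlMr ?ler_pdivrMr ?mulr_gt0 //; apply/andP; split; lra.
Qed.

(** First-order optimality; it replaces strong convexity, as the objective is
    quadratic. *)
Lemma box_argmin_opt (g a y : R) : 0 <= a -> -1 <= y <= 1 ->
  0 <= (g + 2 * a * box_argmin g a) * (y - box_argmin g a).
Proof.
move=> a0 /andP[y1 y2]; rewrite /box_argmin.
case: ltP => [h|h1]; first by rewrite mulr_ge0 //; lra.
case: ltP => [h|h2]; first by rewrite mulr_le0 //; lra.
have [a00|aN0] := eqVneq a 0.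
  by have -> : g = 0 by [move: h1 h2; rewrite a00; lra]; rewrite a00 !(mulr0, mul0r, add0r).
by rewrite mulrCA divff ?mulf_neq0 // mulr1 subrr mul0r.
Qed.

Lemma best_response_arith (g x z a b e : R) : `|a - b| <= e ->
  0 <= (g + 2 * a * x) * (z - x) -> -1 <= z <= 1 -> -1 <= x <= 1 ->
  x ^+ 2 * b - z ^+ 2 * b + (z - x) ^+ 2 * b <= g * (z - x) + 4 * e.
Proof.
move=> abe opt /andP[z1 z2] /andP[x1 x2].
have x2' : `|x * (z - x)| <= 1 * 2.
  by rewrite normrM ler_pM // ler_norml; apply/andP; split; lra.
have : `|(a - b) * (x * (z - x))| <= e * 2 by rewrite normrM ler_pM // -[2]mul1r.
rewrite ler_norml => /andP[_].
have -> : x ^+ 2 * b - z ^+ 2 * b + (z - x) ^+ 2 * b =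
  2 * ((a - b) * (x * (z - x))) - 2 * a * x * (z - x) by ring.
rewrite mulrDl in opt; lra.
Qed.

Lemma potential_arith (P' P e r Gy Gx gy gx a w t eta : R) : P' <= P + e + r ->
  r <= Gy + gy - (Gx + gx) + 4 * eta -> P <= a + Gx + w + t * (4 * eta) ->
  P' <= a + (Gy + gy) + (w + e - gx) + (t + 1) * (4 * eta).
Proof. by rewrite (mulrDl t 1); lra. Qed.

Lemma linearized_arith (e Gy gy gx w t eta ey cy cx py cs : R) :
  gy - gx + e <= ey + cy - cx + 2 * eta ->
  Gy + w <= py + t * cy - cs + t * (2 * eta) ->
  Gy + gy + (w + e - gx) <= ey + py + (t + 1) * cy - (cs + cx) + (t + 1) * (2 * eta).
Proof. by rewrite !(mulrDl t 1); lra. Qed.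

Record solver_state := SolverState {
  s_sum : 'cV[R]_n;
  s_last : 'cV[R]_n;
  s_grad : 'cV[R]_n;
  s_hist : seq (query R n) }.

Definition solver_start : solver_state := SolverState 0 0 0 [::].

(** The last play is counted twice, the second time as a prediction of the next one;
    hence t + 1 copies of B after t rounds. *)
Definition solver_query (alpha : R) (s : solver_state) : query R n :=
  Query (alpha^-1 *: (s_sum s + s_last s)) (- alpha^-1 *: sqv (s_last s))
    (- (alpha^-1 * (size (s_hist s)).+1%:R)).

Definition grad_estimate c (V : (n + n).-tuple R) : 'cV[R]_n :=
  \col_i (tnth V (lshift n i) + c i 0).

(** The true value is nonnegative, so that truncation at 0 does not increase the error
    and keeps the objective of the x-player convex. *)
Definition curvature_estimate (V : (n + n).-tuple R) : 'cV[R]_n :=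
  \col_i Num.max (tnth V (rshift n i)) 0.

Definition solver_update (alpha : R) c (s : solver_state) (V : (n + n).-tuple R) :
    solver_state :=
  let g := s_grad s + grad_estimate c V in
  let x := \col_i box_argmin (g i 0) (curvature_estimate V i 0) in
  SolverState (s_sum s + x) x g (solver_query alpha s :: s_hist s).

Definition solver_invariant (t : nat) (s : solver_state) : Prop :=
  [/\ size (s_hist s) = t, box (s_last s) & forall i, `|s_sum s i 0| <= t%:R].

Lemma solver_invariant_start : solver_invariant 0 solver_start.
Proof.
split=> // [i|i]; rewrite /= mxE ?normr0 //; lra.
Qed.

Lemma solver_update_box alpha c s V : box (s_last (solver_update alpha c s V)).
Proof. by move=> i; rewrite mxE; apply: box_argmin_bound; rewrite mxE le_max lexx orbT. Qed.

Lemma solver_invariant_update alpha c t s V :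
  solver_invariant t s -> solver_invariant t.+1 (solver_update alpha c s V).
Proof.
move=> [ts bs ss]; split=> /= [|i|i]; first by rewrite ts.
  exact: solver_update_box.
rewrite mxE -natr1; apply: le_trans (ler_normD _ _) _; rewrite lerD //.
rewrite ler_norml; exact: solver_update_box.
Qed.

Lemma solver_query_bounded (alpha : R) t s : 0 < alpha -> solver_invariant t s ->
  query_bounded (t.+1%:R / alpha) (solver_query alpha s).
Proof.
move=> a0 [ts bs ss]; have ia : 0 <= alpha^-1 by rewrite invr_ge0 ltW.
split=> [i|i|] /=.
- rewrite !mxE normrM (ger0_norm ia) mulrC ler_wpM2r // -natr1.
  apply: le_trans (ler_normD _ _) _; rewrite lerD //.
  by rewrite ler_norml; exact: bs.
- rewrite !mxE normrM normrN (ger0_norm ia) mulrC ler_wpM2r //.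
  rewrite ger0_norm ?sqr_ge0 //; apply: (@le_trans _ _ 1); last by rewrite ler1n.
  by have /andP[b1 b2] := bs i; nra.
- by rewrite normrN normrM (ger0_norm ia) ts mulrC ger0_norm.
Qed.

End Solver.

Section Progress.
Variables (R : realType) (n d : nat) (A : 'I_n -> 'M[R]_d) (B : 'M[R]_d) (c : 'cV[R]_n).
Hypothesis d_gt0 : (0 < d)%N.
Hypothesis symA : forall i, mxsym (A i).
Hypothesis symB : mxsym B.
Variables (eps' gamma' : R).
Hypothesis eps'_ge0 : 0 <= eps'.
Hypothesis gamma'_ge0 : 0 <= gamma'.

Local Notation absA := (mxabs_family A).
Local Notation L := (family_norm A).
Hypothesis L_gt0 : 0 < L.
Local Notation alpha := (smoothing A).

Definition answer_ok (q : query R n) (V : (n + n).-tuple R) : Prop :=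
  forall j, `|tnth V j - mxinner (with_abs A j) (gibbs (query_mx A B q))|
    <= eps' * mxinner (mxabs (with_abs A j)) (gibbs (query_mx A B q))
       + gamma' * \tr (mxabs (with_abs A j)).

(** Total error of an accurate answer over all coordinates, in the worst case. *)
Definition oracle_error : R := eps' * L + gamma' * (L * d%:R).

Lemma query_mx_sym q : mxsym (query_mx A B q).
Proof.
apply: mxsymD; last exact: mxsymZ.
by apply: mxsymD; apply: mxsym_lincomb => // i; exact: symabs.
Qed.

Definition played (s : solver_state R n) : 'M[R]_d :=
  \sum_(q <- s_hist s) gibbs (query_mx A B q).

Definition payoff (s : solver_state R n) : 'M[R]_d :=
  lincomb A (s_sum s) - (size (s_hist s))%:R *: B.

Lemma solver_query_mx s : query_mx A B (solver_query alpha s) =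
  alpha^-1 *: (payoff s + (lincomb A (s_last s) - B) - quad A (s_last s)).
Proof.
rewrite /query_mx /solver_query /= /payoff /quad !lincombZ lincombD -natr1.
by apply/matrixP => i j; rewrite !mxE; ring.
Qed.

(** Here W stands for the sum of <Y_s, A(x_s) - B> - <g_s, x_s> over the rounds played.
    The first inequality uses the gradient estimates exactly as the algorithm does, and
    only the second passes to the true gradients. Replacing G by the true gradients
    within a round would cost t times the oracle error in round t. *)
Definition progress (s : solver_state R n) : Prop :=
  let t := (size (s_hist s))%:R in
  exists W, forall y, box y ->
  alpha * logpart (alpha^-1 *: lookahead A (payoff s) (s_last s) y) <=
    alpha * ln d%:R + dot (s_grad s) y + W + t * (4 * oracle_error) /\
  dot (s_grad s) y + W <= mxinner (played s) (lincomb A y - B)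
    + t * dot c y - dot c (s_sum s) + t * (2 * oracle_error).

Lemma progress_start : progress (solver_start R n).
Proof.
have a0 : 0 < alpha by rewrite mulr_gt0.
exists 0 => y by_; rewrite /= /payoff /played /= !mul0r big_nil.
have dot0 z : dot 0 z = 0 :> R by rewrite /dot big1 // => i _; rewrite mxE mul0r.
have dot0r z : dot z 0 = 0 :> R by rewrite /dot big1 // => i _; rewrite mxE mulr0.
rewrite dot0 dot0r !addr0 mxinnerC mxinner0r oppr0 addr0; split=> //.
rewrite ler_wpM2l ?(ltW a0) // lincomb0 scale0r subrr.
apply: logpart_nonpos => //.
  by apply: mxsymZ; apply: lookahead_sym => //; exact: trmx0.
move=> v; rewrite -scalerN qformZ mulr_ge0 ?invr_ge0 ?(ltW a0) //.
exact: lookahead0_nonpos.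
Qed.

Lemma payoff_update s V : payoff (solver_update alpha c s V) =
  payoff s + (lincomb A (s_last (solver_update alpha c s V)) - B).
Proof.
rewrite /payoff /= lincombD -natr1 scalerDl scale1r.
by apply/matrixP => i j; rewrite !mxE; ring.
Qed.

Section Answer.
Variables (s : solver_state R n) (V : (n + n).-tuple R).
Hypothesis bs : box (s_last s).
Local Notation q := (solver_query alpha s).
Hypothesis Vok : answer_ok q V.
Let Y := gibbs (query_mx A B q).
Let s' := solver_update alpha c s V.

Let Y_spec : spectraplex Y.
Proof. by apply: gibbs_spectraplex => //; exact: query_mx_sym. Qed.

Definition coord_error i : R :=
  eps' * mxinner Y (mxabs (A i)) + gamma' * \tr (mxabs (A i)).

Lemma sum_coord_error : \sum_i coord_error i <= oracle_error.
Proof.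
rewrite big_split /= -!mulr_sumr; apply: lerD; rewrite ler_wpM2l //.
  exact: sum_abs_inner.
exact: sum_abs_tr.
Qed.

Lemma grad_accurate i : `|tnth V (lshift n i) - mxinner Y (A i)| <= coord_error i.
Proof.
have := Vok (lshift n i); rewrite /with_abs -[lshift n i]/(unsplit (inl i)) unsplitK.
by rewrite !(mxinnerC _ Y).
Qed.

Lemma curvature_accurate i :
  `|curvature_estimate V i 0 - mxinner Y (mxabs (A i))| <= coord_error i.
Proof.
have := Vok (rshift n i); rewrite /with_abs -[rshift n i]/(unsplit (inr i)) unsplitK.
have -> : mxabs (mxabs (A i)) = mxabs (A i).
  by apply: psd_mxabs; [exact: mxabs_sym|exact: mxabs_psd].
rewrite !(mxinnerC _ Y) -/(coord_error i) => h; rewrite mxE.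
have b0 : 0 <= mxinner Y (mxabs (A i)).
  by case: Y_spec => sY pY _; apply: mxinner_ge0 => //; exact: mxabs_psd.
case: (leP 0 (tnth V (rshift n i))) => // Vneg.
by move: h; rewrite !ler_norml => /andP[h1 h2]; apply/andP; split; lra.
Qed.

(** The left-hand side is the sum of -2 b x (y - x), where b is the true curvature
    <Y, |A_i|>; optimality of x bounds the same sum with the estimated curvature. *)
Lemma best_response_le y : box y ->
  mxinner Y (quad A (s_last s') - quad A y + quad A (y - s_last s')) <=
  dot (s_grad s') (y - s_last s') + 4 * oracle_error.
Proof.
move=> by_; have bs' : box (s_last s') by exact: solver_update_box.
have opt i : 0 <= (s_grad s' i 0 + 2 * curvature_estimate V i 0 * s_last s' i 0) *
    (y i 0 - s_last s' i 0).
  have -> : s_last s' i 0 = box_argmin (s_grad s' i 0) (curvature_estimate V i 0).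
    by rewrite [LHS]mxE.
  by apply: box_argmin_opt => //; rewrite mxE le_max lexx orbT.
move: (s_last s') (s_grad s') bs' opt => X G bX opt.
apply: le_trans (lerD (lexx _) (ler_wpM2l (ler0n _ 4) sum_coord_error)).
rewrite mxinnerDr mxinnerBr /quad !mxinner_lincomb /dot mulr_sumr.
rewrite -sumrB -!big_split /=; apply: ler_sum => i _.
have := bX i; have := by_ i; have := opt i; have := curvature_accurate i.
rewrite /mxabs_family.
move: (curvature_estimate V) => C; rewrite !mxE.
 exact: best_response_arith.
Qed.

Lemma grad_step_le y : box y ->
  dot (grad_estimate c V) (y - s_last s') + mxinner Y (lincomb A (s_last s') - B) <=
  mxinner Y (lincomb A y - B) + dot c y - dot c (s_last s') + 2 * oracle_error.
Proof.
move=> by_; have bs' : box (s_last s') by exact: solver_update_box.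
move: (s_last s') bs' => X bX.
have h : dot (grad_estimate c V) (y - X) <=
    mxinner Y (lincomb A y) - mxinner Y (lincomb A X)
    + dot c (y - X) + 2 * \sum_i coord_error i.
  rewrite !mxinner_lincomb /dot mulr_sumr -sumrB -!big_split /=.
  apply: ler_sum => i _; have := grad_accurate i; have := bX i; have := by_ i.
  rewrite !mxE.
  move: (tnth V (lshift n i)) (mxinner Y (A i)) (coord_error i) => v b e.
  move: (X i 0) (y i 0) (c i 0) => x z k /andP[z1 z2] /andP[x1 x2] vbe.
  have : `|(v - b) * (z - x)| <= e * 2.
    by rewrite normrM ler_pM // ler_norml; apply/andP; split; lra.
  rewrite ler_norml => /andP[_].
  by have -> : (v + k) * (z - x) = (v - b) * (z - x) + (z * b - x * b) + k * (z - x); [ring|lra].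
have := sum_coord_error; move: h; rewrite !dotBr !mxinnerBr.
lra.
Qed.

(** The new potential at y is compared with the old one at the play x_t just made, so
    that <G_{t-1}, x_t> + <G_t, y - x_t> = <G_t, y> - <g_t, x_t>, the last term of which
    goes into W. *)
Lemma progress_update : progress s -> progress s'.
Proof.
move=> [W HW]; have bs' : box (s_last s') by exact: solver_update_box.
exists (W + mxinner Y (lincomb A (s_last s') - B)
          - dot (grad_estimate c V) (s_last s')) => y by_.
have sZ : mxsym (payoff s).
  apply: mxsymD; first exact: mxsym_lincomb.
  by apply: mxsymN; exact: mxsymZ.
have defY : Y = gibbs (alpha^-1 *: (payoff s + (lincomb A (s_last s) - B)
    - quad A (s_last s))) by rewrite /Y solver_query_mx.
have step := potential_step d_gt0 symA symB defY L_gt0 sZ bs bs' by_.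
have resp := best_response_le by_; have gstep := grad_step_le by_.
have [pot1 _] := HW _ bs'; have [_ lin] := HW _ by_.
rewrite payoff_update -/s'.
have gradE : s_grad s' = s_grad s + grad_estimate c V by [].
have sumE : s_sum s' = s_sum s + s_last s' by [].
have playedE X : mxinner (played s') X = mxinner Y X + mxinner (played s) X.
  by rewrite mxinnerC /played big_cons mxinnerDr !(mxinnerC X).
have sizeE : size (s_hist s') = (size (s_hist s)).+1 by [].
rewrite playedE sizeE -natr1 gradE sumE.
rewrite gradE dotBr !dotDl in resp; rewrite dotBr in gstep; rewrite !dotDl dotDr.
split; first exact: potential_arith step resp pot1.
exact: linearized_arith gstep lin.
Qed.

End Answer.
End Progress.

(** * Probability of success *)

Section Probability.
Variable R : realType.
Local Open Scope ereal_scope.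
Import HBNNSimple.

(** A nonnegative integral is a supremum over simple functions; p times the indicator
    of G is one of them. The integrands of prob_in need not be measurable, and this
    lower bound is enough for them. *)
Lemma integral_ge_indic d (T : measurableType d) (mu : {measure set T -> \bar R})
    (f : T -> \bar R) (G : set T) (p : R) :
  (forall x, 0 <= f x) -> measurable G -> (0 <= p)%R ->
  (forall x, G x -> p%:E <= f x) -> p%:E * mu G <= \int[mu]_x f x.
Proof.
move=> f0 mG p0 pf; pose h := scale_nnsfun (indic_nnsfun R mG) p0.
have -> : p%:E * mu G = sintegral mu h.
  transitivity (\int[mu]_x (h x)%:E); last first.
    by rewrite integral_nnsfun // patch_setT.
  have -> : (fun x => (h x)%:E) = (fun x => (p * \1_G x)%:E) by [].
  rewrite (@integralZl_indic _ _ _ mu setT measurableT (fun=> G) p) //; last by rewrite ltNge p0.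
  by rewrite integral_indic // setIT.
rewrite ge0_integralTE //; apply: ereal_sup_ubound; exists h => // x /=.
rewrite [X in (_ * X)%R]indicE; have [xG|xG] := boolP (x \in G).
  by rewrite mulr1; apply: pf; rewrite inE in xG.
by rewrite mulr0.
Qed.

Lemma prob_in_ge0 d (V : measurableType d) Q S (orc : Q -> probability V R)
  (p : proc Q V S) (E : set S) : 0 <= prob_in orc p E.
Proof.
elim: p => [s|q r IH] /=; first by rewrite lee_fin.
by apply: integral_ge0 => v _; exact: IH.
Qed.

Section Iteration.
Variables (n : nat) (a : algorithm R n).
Variables (qry : state a -> query R n) (upd : state a -> (n + n).-tuple R -> state a).
Hypothesis iter_stepE : forall s, iter_step s = Call (qry s) (fun v => Ret _ _ (upd s v)).
Variable J : nat -> state a -> Prop.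

Lemma all_queries_run (admissible : query R n -> Prop) (T : nat) :
  (forall t s, (t < T)%N -> J t s -> admissible (qry s)) ->
  (forall t s v, J t s -> J t.+1 (upd s v)) ->
  forall k s, (k <= T)%N -> J (T - k) s -> all_queries admissible (run_from k s).
Proof.
move=> adm step; elim=> [|k IH] s kT Js //=; rewrite iter_stepE /=.
split; first by apply: (adm (T - k.+1)%N) => //; rewrite ltn_subrL (leq_trans _ kT).
by move=> v; apply: IH; rewrite ?(ltnW kT) // -(subnSK kT); exact: step.
Qed.

(** J is an invariant that accurate answers preserve. The bound on the chance of an
    accurate answer holds conditionally on the past, so that the chances multiply. *)
Lemma prob_in_run (orc : query R n -> probability ((n + n).-tuple R) R)
    (good : query R n -> set ((n + n).-tuple R)) (E : set (state a)) (T : nat) (r : R) :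
  (0 <= r)%R ->
  (forall q, measurable (good q)) ->
  (forall t s, (t < T)%N -> J t s -> r%:E <= orc (qry s) (good (qry s))) ->
  (forall t s v, J t s -> good (qry s) v -> J t.+1 (upd s v)) ->
  (forall s, J T s -> E s) ->
  forall k s, (k <= T)%N -> J (T - k) s ->
    (r ^+ k)%:E <= prob_in orc (run_from k s) E.
Proof.
move=> r0 mgood likely step fin; elim=> [|k IH] s kT Js.
  rewrite subn0 in Js; rewrite expr0 /= indicE.
  by rewrite (_ : s \in E) //; apply/mem_set/fin.
rewrite /= iter_stepE /=.
apply: (@le_trans _ _ ((r ^+ k)%:E * orc (qry s) (good (qry s)))).
  rewrite exprSr EFinM; apply: lee_wpmul2l; first by rewrite lee_fin exprn_ge0.
  by apply: (likely (T - k.+1)%N) => //; rewrite ltn_subrL (leq_trans _ kT).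
apply: integral_ge_indic => // [x||v gv]; first exact: prob_in_ge0.
  exact: exprn_ge0.
by apply: IH; rewrite ?(ltnW kT) // -(subnSK kT); exact: step.
Qed.

End Iteration.

Lemma measurable_tuple_box N (b e : 'I_N -> R) :
  measurable [set V : N.-tuple R | forall j, (`|tnth V j - b j| <= e j)%R].
Proof.
have -> : [set V : N.-tuple R | forall j, (`|tnth V j - b j| <= e j)%R] =
    \bigcap_(j in [set: 'I_N]) ((fun V : N.-tuple R => tnth V j) @^-1`
      [set` `[(b j - e j)%R, (b j + e j)%R]]).
  apply/seteqP; split => [V VP j _|V VP j].
    by have := VP j; rewrite /= in_itv /= ler_distl.
  by have := VP j I; rewrite /= in_itv /= ler_distl.
apply: fin_bigcap_measurable => //.
move=> j _; rewrite -[X in measurable X]setTI; apply: measurable_tnth => //.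
Qed.

Lemma bernoulli_pow (x : R) (m : nat) : (0 <= x <= 1 -> 1 - m%:R * x <= (1 - x) ^+ m)%R.
Proof.
move=> /andP[x0 x1]; elim: m => [|m IH]; first by rewrite mul0r subr0 expr0.
have x1' : (0 <= 1 - x)%R by rewrite subr_ge0.
rewrite exprS; apply: le_trans (ler_wpM2l x1' IH).
rewrite -natr1 -subr_ge0 (_ : _ - _ = m%:R * x ^+ 2)%R; last by ring.
by rewrite mulr_ge0 // sqr_ge0.
Qed.

End Probability.

(** * Saddle points and complexity *)

Section Conclusion.
Variables (R : realType) (n d : nat) (A : 'I_n -> 'M[R]_d) (B : 'M[R]_d) (c : 'cV[R]_n).
Hypothesis d_gt0 : (0 < d)%N.
Hypothesis symA : forall i, mxsym (A i).
Hypothesis symB : mxsym B.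
Variables (eps' gamma' : R).

Local Notation L := (family_norm A).
Hypothesis L_gt0 : 0 < L.
Local Notation alpha := (smoothing A).

Lemma approx_saddleP (X Z : Type) (DX : set X) (DZ : set Z) (f : X -> Z -> R) eps x z :
  DX x -> DZ z -> (forall x' z', DX x' -> DZ z' -> f x z' - f x' z <= eps) ->
  approx_saddle DX DZ f eps x z.
Proof.
move=> Dx Dz gap; split=> //; rewrite lerBlDl -lerBlDr.
apply: lb_le_inf; first by exists (f x z), x.
move=> _ [x' Dx' <-]; rewrite lerBlDr; apply: ge_sup; first by exists (f x z), z.
by move=> _ [z' Dz' <-]; rewrite -lerBlDl; exact: gap.
Qed.

Lemma quad_inner_le U y : spectraplex U -> box y -> mxinner U (quad A y) <= L.
Proof.
move=> sU by_; apply: le_trans (sum_abs_inner symA sU).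
rewrite mxinner_lincomb; apply: ler_sum => i _; case: sU => sU pU _.
rewrite mxE ler_piMl //; first by apply: mxinner_ge0 => //; exact: mxabs_psd.
by have /andP[y1 y2] := by_ i; nra.
Qed.

Lemma objective_dot x Y :
  objective A B c x Y = mxinner Y (lincomb A x) - mxinner Y B + dot c x.
Proof.
rewrite /objective (mxinnerC B) /dot [in LHS]mxE; congr (_ + _).
by apply: eq_bigr => i _; rewrite mxE.
Qed.

Lemma mx_of_outputZ (s : solver_state R n) (a : R) :
  mx_of_output A B [seq (a, q) | q <- s_hist s] = a *: played A B s.
Proof. by rewrite /mx_of_output /played big_map scaler_sumr. Qed.

Lemma played_psd_tr (s : solver_state R n) : [/\ mxsym (played A B s), psd (played A B s)
  & \tr (played A B s) = (size (s_hist s))%:R].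
Proof.
rewrite /played; elim: (s_hist s) => [|q l [sP pP tP]].
  rewrite big_nil mxtrace0; split=> //; first exact: trmx0.
  by move=> v; rewrite /qform mulmx0 mul0mx mxE.
have [sG pG tG] := gibbs_spectraplex d_gt0 (query_mx_sym symA symB q).
rewrite big_cons; split; first exact: mxsymD.
  by move=> v; rewrite qformD addr_ge0 // pG.
by rewrite mxtraceD tG tP /= -[RHS]natr1 addrC.
Qed.

Lemma gap_arith (p lg UA UB UQ UN cs pA pB cu eta w g Lf Te t : R) :
  UA - t * UB - UQ + 2^-1 * UN <= p -> p <= lg + g + w + t * (4 * eta) ->
  g + w <= pA - pB + t * cu - cs + t * (2 * eta) ->
  0 <= UN -> UQ <= Lf -> lg + Lf + t * (6 * eta) <= Te ->
  UA - t * UB + cs - (pA - pB + t * cu) <= Te.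
Proof. by lra. Qed.

(** The comparator u is used as the play that would follow the last one, so that the
    potential at u already contains the linear terms of the gap. *)
Lemma saddle_of_progress t (eps : R) (s : solver_state R n) :
  (0 < t)%N -> solver_invariant t s -> progress A B c eps' gamma' s ->
  alpha * ln d%:R + L + t%:R * (6 * oracle_error A eps' gamma') <= t%:R * eps ->
  approx_saddle (box (n:=n)) (spectraplex (d:=d)) (objective A B c) eps
    (t%:R^-1 *: s_sum s) (mx_of_output A B [seq (t%:R^-1, q) | q <- s_hist s]).
Proof.
move=> t0 [szs bs sums] [W HW] budget.
have t1 : 0 < t%:R :> R by rewrite ltr0n.
have [sP pP tP] := played_psd_tr s.
apply: approx_saddleP => [i||u U bu sU].
- rewrite mxE mulrC -ler_norml normrM (gtr0_norm (x := t%:R^-1)) ?invr_gt0 //.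
  by rewrite ler_pdivrMr // mul1r.
- rewrite mx_of_outputZ; split; first exact: mxsymZ.
    by move=> v; rewrite -/(qform _ v) qformZ mulr_ge0 ?invr_ge0 ?(ltW t1) ?pP.
  by rewrite mxtraceZ tP szs mulVf // gt_eqF.
have a0 : 0 < alpha by rewrite mulr_gt0.
have [pot lin] := HW _ bu; rewrite szs in pot lin.
have sPay : mxsym (payoff A B s).
  apply: mxsymD; first exact: mxsym_lincomb.
  by apply: mxsymN; exact: mxsymZ.
have sLook := mxsymZ alpha^-1 (lookahead_sym symA (s_last s) u sPay).
have := ler_wpM2l (ltW a0) (mxinner_le_logpart d_gt0 sU sLook).
rewrite mxinnerZr mulrA divff ?gt_eqF // mul1r => up.
have N0 : 0 <= mxinner U (quad A (u - s_last s)).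
  by case: (sU) => ? ? _; apply: mxinner_ge0 => //; exact: quad_psd.
have QL := quad_inner_le sU bu.
have lookE : mxinner U (lookahead A (payoff A B s) (s_last s) u) =
    mxinner U (lincomb A (s_sum s)) - t%:R * mxinner U B - mxinner U (quad A u)
    + 2^-1 * mxinner U (quad A (u - s_last s)).
  by rewrite /lookahead /payoff szs !(mxinnerDr, mxinnerNr, mxinnerZr).
rewrite lookE in up; rewrite mxinnerBr in lin.
have dotZ : dot c (t%:R^-1 *: s_sum s) = t%:R^-1 * dot c (s_sum s).
  by rewrite /dot mulr_sumr; apply: eq_bigr => i _; rewrite mxE mulrCA.
have mxinnerZl (X Y : 'M[R]_d) : mxinner (t%:R^-1 *: X) Y = t%:R^-1 * mxinner X Y.
  by rewrite mxinnerC mxinnerZr mxinnerC.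
rewrite -(ler_pM2l t1) mulrBr mx_of_outputZ !objective_dot lincombZ !mxinnerZl.
rewrite mxinnerZr dotZ !(mulrDr t%:R) !mulrN !mulrA divff ?gt_eqF // !mul1r.
exact: gap_arith up pot lin N0 QL budget.
Qed.

End Conclusion.

Section SaddleSolver.
Variable R : realType.

Lemma ln_ge_half (d : nat) : (2 <= d)%N -> 1 / 2 <= ln d%:R :> R.
Proof.
move=> d2; have d0 : 0 < d%:R :> R by rewrite ltr0n (leq_trans _ d2).
rewrite -ler_expR lnK ?posrE //; apply: (@le_trans _ _ 2); last by rewrite ler_nat.
have h := expR_ge1Dx (- (1 / 2) : R).
have e0 := expR_gt0 (1 / 2 : R); have := expRxMexpNx_1 (1 / 2 : R).
move: (expR (1 / 2)) (expR (- (1 / 2))) h e0 => a b h a0 ab.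
have : a * (1 / 2) <= 1 by rewrite -[leRHS]ab ler_wpM2l ?(ltW a0) //; lra.
lra.
Qed.

Lemma opnorm0 d : @opnorm R d 0 <= 0.
Proof.
rewrite /opnorm psd_mxabs; last 2 first.
- exact: trmx0.
- by move=> v; rewrite /qform mulmx0 mul0mx mxE.
set E := [set a | _]; have [->|/set0P E0] := eqVneq E set0; first by rewrite sup0.
apply: ge_sup => // a /eigenvalueP[v]; rewrite mulmx0 => /esym/eqP.
by rewrite scaler_eq0 => /orP[/eqP ->|->].
Qed.

(** The empty family has norm 0; so the hypothesis on eps excludes it, and dividing by n
    in the accuracy of the oracle makes sense. *)
Lemma family_norm_gt0 n d (A : 'I_n -> 'M[R]_d) : 0 < family_norm A -> (0 < n)%N.
Proof.
case: n A => // A; rewrite /family_norm big_ord0 => /lt_le_trans/(_ (opnorm0 d)).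
by rewrite ltxx.
Qed.

(** 292 = 2 (144 + 2): half of eps pays for alpha ln d + L, as L <= 2 L ln d, and the
    other half for the oracle errors. *)
Definition saddle_iterations (d : nat) (L eps : R) : nat :=
  (Num.truncn (292 * (L * ln d%:R / eps))).+1.

Definition saddle_solver (n d : nat) (L : R) (c : 'cV[R]_n) (eps delta : R) :
    algorithm R n :=
  let T := saddle_iterations d L eps in
  {| start := solver_start R n;
     iter_step := fun s => Call (solver_query (144 * L) s)
                    (fun V => Ret _ _ (solver_update (144 * L) c s V));
     iterations := T;
     output_x := fun s => T%:R^-1 *: s_sum s;
     output_Y := fun s => [seq (T%:R^-1, q) | q <- s_hist s];
     or_eps := eps / (24 * L);
     or_delta := delta / T%:R;
     or_gamma := eps / (24 * (L * n%:R * d%:R)) |}.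

End SaddleSolver.

Theorem theorem3 (R : realType) :
  exists (K : nat) (C c0 : R), [/\ 0 < C, 0 < c0 &
  (* the method is given n, d, L_A, c, eps, delta, but not A and B *)
  exists alg : forall (n d : nat) (L : R) (c : 'cV[R]_n) (eps delta : R),
                 algorithm R n,
  forall (n d : nat) (A : 'I_n -> 'M[R]_d) (B : 'M[R]_d) (c : 'cV[R]_n)
         (eps delta : R),
    (2 <= d)%N ->
    (forall i, mxsym (A i)) -> mxsym B ->
    0 < eps < family_norm A ->
    0 < delta < 1 ->
    let L := family_norm A in
    let a := alg n d L c eps delta in
    let T := (iterations a)%:R : R in
    (* O(T) for the data normalized by L_A, i.e. for A_i / L_A and B / L_A *)
    let admissible := query_bounded (C * T / L) in
    [/\ T <= C * (L * ln d%:R / eps),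
        forall s : state a, calls_le K (iter_step s),
        [/\ 0 < or_eps a < 1, 0 < or_delta a < 1 & 0 < or_gamma a < 1],
        [/\ c0 * (eps / L) <= or_eps a <= C * (eps / L),
            delta <= C * T * or_delta a
          & c0 * (eps / (L * n%:R * d%:R)) <= or_gamma a
              <= C * (eps / (L * n%:R * d%:R))]
      & all_queries admissible (run a) /\
        forall orc : query R n -> probability ((n + n).-tuple R) R,
          (forall q, admissible q ->
             meq_law (or_eps a) (or_delta a) (or_gamma a) (with_abs A)
               (query_mx A B q) (orc q)) ->
          ((1 - delta)%:E <=
           prob_in orc (run a)
             [set s | approx_saddle (box (n:=n)) (spectraplex (d:=d))
                        (objective A B c) eps
                        (output_x s) (mx_of_output A B (output_Y s))])%E]].
Proof.
(* 294 = 292 + 2 absorbs the rounding of T, as L ln d / eps >= 1/2 *)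
exists 1%N, 294, (24^-1); split; [by rewrite ltr0n|by rewrite invr_gt0 ltr0n|].
exists (@saddle_solver R) => n d A B c eps delta d2 symA symB /andP[e0 eL] /andP[de0 de1].
move=> L a T admissible.
have L0 : 0 < L by apply: lt_trans eL.
have n0 : (0 < n)%N by apply: family_norm_gt0 L0.
have d0 : (0 < d)%N by apply: leq_trans d2.
have lnd := ln_ge_half R d2.
have n1 : 1 <= n%:R :> R by rewrite ler1n.
have d1 : 1 <= d%:R :> R by rewrite ler1n.
pose X := L * ln d%:R / eps.
have LX : L * ln d%:R = X * eps by rewrite divfK // gt_eqF.
have X2 : 1 / 2 <= X.
  have Le : 1 <= L / eps by rewrite ler_pdivlMr // mul1r ltW.
  by rewrite /X -mulrA mulrCA -[leLHS]mulr1; apply: ler_pM => //; lra.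
have TX1 : 292 * X < T by exact: truncnS_gt.
have X0 : 0 <= X by apply: le_trans X2; rewrite divr_ge0.
have TE : T = (Num.truncn (292 * X))%:R + 1 by rewrite natr1.
have TX2 : T <= 292 * X + 1.
  by rewrite TE lerD2r truncn_le mulr_ge0 ?ler0n.
have T1 : 1 <= T by rewrite ler1n.
have T0 : 0 < T by apply: lt_le_trans T1.
have nd1 : 1 <= n%:R * d%:R :> R by rewrite -[leLHS]mulr1 ler_pM.
have adm (t : nat) s : (t < iterations a)%N -> solver_invariant t s ->
    admissible (solver_query (144 * L) s).
  move=> tT inv.
  have [b1 b2 b3] := solver_query_bounded (mulr_gt0 (ltr0n _ 144) L0) inv.
  have le : t.+1%:R / (144 * L) <= 294 * T / L.
    have tT' : t.+1%:R <= T by rewrite ler_nat.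
    rewrite ler_pdivrMr ?mulr_gt0 //.
    by have -> : 294 * T / L * (144 * L) = 294 * 144 * T by [field; rewrite gt_eqF]; lra.
  by split=> [i|i|]; [exact: le_trans (b1 i) le|exact: le_trans (b2 i) le|exact: le_trans b3 le].
have ee : eps / L < 1 by rewrite ltr_pdivrMr // mul1r.
have ee0 : 0 < eps / L by rewrite divr_gt0.
have epsE : or_eps a = 24^-1 * (eps / L) by rewrite /= invfM; ring.
have gE : or_gamma a = 24^-1 * (eps / (L * n%:R * d%:R)) by rewrite /= invfM; ring.
have g0 : 0 < eps / (L * n%:R * d%:R).
  by rewrite divr_gt0 // !mulr_gt0 // ?ltr0n.
have gle : eps / (L * n%:R * d%:R) <= eps / L.
  rewrite ler_pM2l // lef_pV2 ?posrE ?mulr_gt0 ?ltr0n //.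
  by rewrite -mulrA ler_peMr // ltW.
split.
- by rewrite -/X; lra.
- by move=> s /=.
- rewrite epsE gE; split; apply/andP; split; try lra.
    by rewrite divr_gt0.
  by rewrite ltr_pdivrMr //; apply: lt_le_trans de1 _; rewrite mul1r.
- rewrite epsE gE; split; try by [apply/andP; split; lra].
  have -> : 294 * T * or_delta a = 294 * delta by rewrite /=; field; rewrite gt_eqF.
  lra.
split.
  apply: (all_queries_run (a := a) (J := @solver_invariant R n) (T := iterations a)
    (fun s => erefl _)) => //.
  - by move=> t s v; apply: solver_invariant_update.
  - by rewrite subnn; exact: solver_invariant_start.
move=> orc orcP.
have r0 : 0 <= 1 - delta / T.
  by rewrite subr_ge0 ler_pdivrMr // mul1r; apply: le_trans T1; exact: ltW.
pose good q : set ((n + n).-tuple R) :=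
  [set V | answer_ok A B (or_eps a) (or_gamma a) q V].
pose J t s := solver_invariant t s /\ progress A B c (or_eps a) (or_gamma a) s.
have eps0 : 0 <= or_eps a by rewrite epsE; lra.
have gam0 : 0 <= or_gamma a by rewrite gE; lra.
apply: (@le_trans _ _ ((1 - delta / T) ^+ iterations a)%:E).
  rewrite lee_fin; apply: le_trans (bernoulli_pow _ _); last first.
    apply/andP; split; first by rewrite divr_ge0 // ltW.
    by rewrite -subr_ge0.
  by rewrite -/T mulrCA divff ?gt_eqF // mulr1.
have err : oracle_error A (or_eps a) (or_gamma a) <= eps / 12.
  have -> : oracle_error A (or_eps a) (or_gamma a) = eps / 24 * (1 + n%:R^-1).
    by rewrite /oracle_error -/L epsE gE; field; rewrite !gt_eqF ?ltr0n.
  have n2 : n%:R^-1 <= 1 :> R by rewrite invf_le1 ?ltr0n.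
  have -> : eps / 12 = eps / 24 * 2 by lra.
  by rewrite ler_wpM2l ?divr_ge0 ?ler0n ?(ltW e0) //; lra.
have budget : smoothing A * ln d%:R + L
    + T * (6 * oracle_error A (or_eps a) (or_gamma a)) <= T * eps.
  have h1 : T * (6 * oracle_error A (or_eps a) (or_gamma a)) <= T * (eps / 2).
    by rewrite ler_wpM2l ?(ltW T0) //; lra.
  have h2 : L <= 2 * (L * ln d%:R) by rewrite mulrCA ler_peMr ?(ltW L0) //; lra.
  have h3 : 292 * X * eps <= T * eps by rewrite ler_wpM2r // ltW.
  by rewrite /smoothing -/L -mulrA LX; rewrite LX in h2; lra.
apply: (prob_in_run (a := a) (J := J) (good := good) (T := iterations a)
  (fun s => erefl _)) => //.
- by move=> q; apply: measurable_tuple_box.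
- move=> t s tT [inv _]; apply: orcP; exact: adm inv.
- move=> t s V [inv prog] ok; split; first exact: solver_invariant_update.
  by apply: progress_update => //; case: inv.
- by move=> s [inv prog]; apply: (saddle_of_progress d0 symA symB L0 _ inv prog).
- rewrite subnn; split; first exact: solver_invariant_start.
  exact: progress_start.
Qed.
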